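(* Let $K$ be an infinite field of arbitrary characteristic, let $m\ge 1$, $r,s\ge 0$, let $V$ be the natural $m$-dimensional $GL(m)$-module over $K$, $W=V^*$ its dual, and let $\delta=m$ (as an element of $K$). Then there is an isomorphism $$S(m,r,s)\simeq \mathrm{End}_{B_{r,s}(\delta)}(V^{\otimes r}\otimes W^{\otimes s})^{op},$$ namely the one given by the map $\Psi_{r,s}$; that is, $\Psi_{r,s}$ is surjective onto $\mathrm{End}_{B_{r,s}(\delta)}(V^{\otimes r}\otimes W^{\otimes s})^{op}$.
   Context: $V$ has basis $v_1,\dots,v_m$ and $W=V^*$ has the dual basis $v_1^*,\dots,v_m^*$. For a multi-index $I=(i_1,\dots,i_{r+s})$ with entries in $\{1,\dots,m\}$ put $v_I=v_{i_1}\otimes\cdots\otimes v_{i_r}\otimes v^*_{i_{r+1}}\otimes\cdots\otimes v^*_{i_{r+s}}$; these form a basis of $V^{\otimes r}\otimes W^{\otimes s}$. The walled Brauer algebra $B_{r,s}(\delta)$ is the $K$-algebra with basis the diagrams on upper vertices $\overline 1,\dots,\overline{r+s}$ and lower vertices $\underline 1,\dots,\underline{r+s}$ which are perfect matchings such that each vertical edge joins an upper to a lower vertex with both indices in $\{1,\dots,r\}$ or both in $\{r+1,\dots,r+s\}$, and each horizontal edge joins two upper vertices or two lower vertices, one with index in $\{1,\dots,r\}$ and the other with index in $\{r+1,\dots,r+s\}$. The product $\sigma\tau$ is obtained by placing $\sigma$ under $\tau$, concatenating, removing the $t$ internal cycles, and multiplying by $\delta^t$. It is generated by $\tau_1,\dots,\tau_{r+s-1}$: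 for $j\ne r$, $\tau_j$ is the diagram of the transposition $(j,j+1)$; and (if $r,s\ge1$) $\tau_r$ joins $\overline j$ to $\underline j$ for $j\neq r,r+1$, $\overline r$ to $\overline{r+1}$ and $\underline r$ to $\underline{r+1}$. If $r=0$ or $s=0$ there is no generator $\tau_r$ and $B_{r,s}(\delta)$ is the group algebra of a symmetric group. Right action of $B_{r,s}(\delta)$ on $V^{\otimes r}\otimes W^{\otimes s}$: for $j\ne r$, $(v_I)\tau_j=v_{I.(j,j+1)}$, where $I.(j,j+1)$ is $I$ with its $j$th and $(j+1)$st entries exchanged; and $(v_I)\tau_r=\delta_{i_r,i_{r+1}}\sum_{k=1}^{m} v_{i_1}\otimes\cdots\otimes v_{i_{r-1}}\otimes v_k\otimes v_k^*\otimes v^*_{i_{r+2}}\otimes\cdots\otimes v^*_{i_{r+s}}$, with $\delta_{i_r,i_{r+1}}$ the Kronecker delta. $GL(m)$ acts diagonally on the left; correspondingly the distribution algebra (hyperalgebra) $Dist(GL(m))$ acts, with $e_{ij}\in Dist_1(GL(m))$ acting by $e_{ij}v_k=\delta_{jk}v_i$ on $V$, $e_{ij}v_k^*=-\delta_{ik}v_j^*$ on $W$, and as derivations on tensor products. The two actions commute, and $\Psi_{r,s}: Dist(GL(m))\to \mathrm{End}_{B_{r,s}(\delta)}(V^{\otimes r}\otimes W^{\otimes s})^{op}$ denotes the induced map sending an element to the operator by which it acts. $\mathrm{End}_{B_{r,s}(\delta)}(V^{\otimes r}\otimes W^{\otimes s})$ is the space of all $K$-linear endomorphisms commuting with the action of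 $B_{r,s}(\delta)$. The rational Schur algebra $S(m,r,s)$ is by definition the image of $Dist(GL(m))$ in $\mathrm{End}_K(V^{\otimes r}\otimes W^{\otimes s})$. The superscript $op$ is a convention about the order of composition; surjectivity of $\Psi_{r,s}$ means that, as subspaces of $\mathrm{End}_K(V^{\otimes r}\otimes W^{\otimes s})$, $S(m,r,s)$ equals $\mathrm{End}_{B_{r,s}(\delta)}(V^{\otimes r}\otimes W^{\otimes s})$. *)

(* Defs.v *)
From HB Require Import structures.
From mathcomp Require Import all_boot all_order all_fingroup all_algebra.
From mathcomp Require Import zify.
From mathcomp Require Import mpoly boolp.
Set Implicit Arguments.
Unset Strict Implicit.
Unset Printing Implicit Defensive.
Import GRing.Theory.
Local Open Scope ring_scope.

Section Gluing.
Variables (X : finType) (M G : X -> X).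
Hypotheses (MK : involutive M) (Mfix : forall x, M x != x) (GK : involutive G).

Definition glueRel : rel X := fun x y => (y == M x) || (y == G x).

Lemma glueRel_sym : ssrbool.symmetric glueRel.
Proof.
move=> x y; rewrite /glueRel eq_sym (can2_eq MK MK).
by rewrite [y == G x]eq_sym (can2_eq GK GK).
Qed.

Lemma connect_glue_sym : connect_sym glueRel.
Proof. exact: sym_connect_sym glueRel_sym. Qed.

Lemma glue_partner (e : X -> bool) u :
  (forall x, e (M x) = ~~ e x) -> (forall x, G x != x -> e (G x) = ~~ e x) ->
  G u = u ->
  exists w, [/\ w != u, G w = w, connect glueRel u w, e w = ~~ e u &
    forall x, connect glueRel u x -> G x = x -> x = u \/ x = w].
Proof.
move=> eM eG Gu; pose p := M \o G.
have p_inj : injective p by apply: inj_comp; apply: inv_inj.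
pose n := fingraph.order p u; pose z k := iter k p u.
have zS k : z k.+1 = M (G (z k)) by [].
have n_gt0 : (0 < n)%N by apply: fingraph.order_gt0.
have zn : z n = u by exact: iter_order.
have zinj i j : (i < n)%N -> (j < n)%N -> z i = z j -> i = j.
  by move=> lti ltj eqz; rewrite -(findex_iter lti) -(findex_iter ltj) -/(z i) eqz.
have Gz k : (k <= n)%N -> G (z k) = z (n - k)%N.
  elim: k => [|k IHk] lekn; first by rewrite subn0 zn.
  by rewrite zS IHk ?(ltnW lekn) // -(subnSK lekn) zS MK GK.
have Mz k : (k < n)%N -> M (z k.+1) = z (n - k)%N.
  by move=> ltkn; rewrite zS MK Gz // ltnW.
have n_even : odd n = false.
  apply/negP=> oddn; have En : n = (n./2).*2.+1 by rewrite -[LHS]odd_double_half oddn.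
  have /eqP[] := Mfix (z n./2.+1); rewrite Mz; last by rewrite En; lia.
  by congr z; rewrite {1}En; lia.
pose q := n./2; have En : n = q.*2 by rewrite -[LHS]odd_double_half n_even.
have q_gt0 : (0 < q)%N by lia.
have ltqn : (q < n)%N by lia.
have conz k : connect glueRel u (z k).
  elim: k => [|k IHk]; first exact: connect0.
  apply: connect_trans IHk (connect_trans (connect1 (y := G (z k)) _) (connect1 _)).
    by rewrite /glueRel eqxx orbT.
  by rewrite zS /glueRel eqxx.
have Gzfix k : (k < n)%N -> G (z k) = z k -> k = 0%N \/ k = q.
  case: k => [|k] ltkn; first by left.
  rewrite Gz ?(ltnW ltkn) // => /zinj; rewrite ltkn ltn_subrL n_gt0 => /(_ isT isT).
  by lia.
exists (z q); split.
- by apply/eqP=> /(zinj q 0%N ltqn n_gt0); lia.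
- by rewrite Gz ?(ltnW ltqn) //; congr z; lia.
- exact: conz.
- have H k : (k < q)%N -> e (z k.+1) = ~~ e u.
    elim: k => [|k IHk] ltkq; first by rewrite zS Gu eM.
    rewrite zS eM eG ?negbK ?IHk ?(ltnW ltkq) //.
    by apply/eqP=> /Gzfix; lia.
  by have := H q.-1; rewrite prednK //; apply; lia.
- move=> x /connectP[s pth ->] Gx.
  suff [k ltkn Ek] : exists2 k, (k < n)%N & last u s = z k.
    by move: Gx; rewrite Ek => /(Gzfix _ ltkn)[->|->]; [left|right].
  elim/last_ind: s pth {Gx} => [|s y IHs]; first by exists 0%N.
  rewrite last_rcons rcons_path => /andP[/IHs[k ltkn Ek]]; rewrite Ek.
  have zmod j : (j <= n)%N -> exists2 k, (k < n)%N & z j = z k.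
    rewrite leq_eqVlt => /predU1P[->|]; last by exists j.
    by exists 0%N; rewrite // zn.
  case/orP=> /eqP->; last by rewrite Gz ?(ltnW ltkn) //; apply/zmod/leq_subr.
  case: k {Ek} ltkn => [|k] ltkn; last by rewrite Mz ?(ltnW ltkn)//; apply/zmod/leq_subr.
  have -> : z 0%N = z n.-1.+1 by rewrite prednK.
  by rewrite Mz ?prednK //; apply/zmod/leq_subr.
Qed.
End Gluing.

Section Labelings.
Variables (X V Y : finType) (e : rel X) (out : V -> X) (b : V -> Y).
Hypothesis e_sym : connect_sym e.

Definition innerSet : pred X := [pred x | [forall v, ~~ connect e (out v) x]].
Definition labelings : {set {ffun X -> Y}} :=
  [set l : {ffun X -> Y} | [forall x, forall y, e x y ==> (l x == l y)] &&
                [forall v, l (out v) == b v]].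
Definition consistent : bool :=
  [forall v, forall w, connect e (out v) (out w) ==> (b v == b w)].

Lemma labelingP (l : {ffun X -> Y}) :
  reflect ((forall x y, connect e x y -> l x = l y) /\ forall v, l (out v) = b v)
          (l \in labelings).
Proof.
rewrite inE; apply: (iffP andP) => -[H1 H2]; split.
- move=> x y /connectP[p + ->] {y}; elim: p x => [//|z p IHp] x /= /andP[exz /IHp<-].
  by apply/eqP; move/forallP/(_ x)/forallP/(_ z)/implyP: H1; apply.
- by move=> v; apply/eqP; move/forallP: H2.
- by apply/'forall_forallP=> x y; apply/implyP=> exy; rewrite (H1 x y) ?connect1.
- by apply/forallP=> v; apply/eqP.
Qed.

Lemma card_labelings :
  #|labelings| = (consistent * #|Y| ^ n_comp e innerSet)%N.
Proof.
case: (boolP consistent) => [|/forallPn[v /forallPn[w]]]; last first.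
  rewrite negb_imply => /andP[cvw /eqP bvw]; rewrite mul0n; apply/eqP.
  rewrite cards_eq0; apply/eqP/setP=> l; rewrite [RHS]inE; apply/labelingP=> -[lc lb].
  by apply: bvw; rewrite -!lb; apply: lc.
move=> /'forall_forallP cb; rewrite mul1n.
pose R0 := {x : X | (x \in roots e) && innerSet x}.
have innerc x y : connect e x y -> innerSet x = innerSet y.
  move=> cxy; apply: eq_forallb => v; congr (~~ _).
  by apply: (same_connect_r e_sym).
pose ext (g : {ffun R0 -> Y}) (x : X) : option Y :=
  if [pick v | connect e (out v) x] is Some v then Some (b v)
  else omap g (insub (fingraph.root e x)).
have rootR0 x : [pick v | connect e (out v) x] = None ->
    (fingraph.root e x \in roots e) && innerSet (fingraph.root e x).
  case: pickP => // nv _; apply/andP; split; first exact: roots_root.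
  rewrite -(innerc x) ?connect_root //.
  by apply/forallP=> v; rewrite nv.
have extS g x : exists y, ext g x == Some y.
  rewrite /ext; case: pickP (rootR0 x) => [v _ _|nv /(_ erefl) H]; first by exists (b v).
  by rewrite insubT /=; eexists; apply: eqxx.
pose h (g : {ffun R0 -> Y}) := [ffun x => xchoose (extS g x)].
have hE g x : Some (h g x) = ext g x by rewrite ffunE; apply/esym/eqP/(xchooseP (extS g x)).
have -> : labelings = h @: setT.
  apply/setP=> l; apply/labelingP/imsetP.
    move=> [lc lb]; exists [ffun x : R0 => l (val x)]; rewrite ?inE //.
    apply/ffunP=> x; apply: Some_inj; rewrite hE /ext.
    case: pickP (rootR0 x) => [v cvx _|nv /(_ erefl) H]; first by rewrite -lb (lc _ _ cvx).
    by rewrite insubT /= ffunE /= -(lc x) // connect_root.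
  move=> [g _ ->]; split.
    move=> x y cxy; apply: Some_inj; rewrite !hE /ext (fingraph.rootP e_sym cxy).
    case: pickP => [v cvx|nv]; case: pickP => [w cwy|nw] //.
    - congr Some; apply/eqP; move/implyP: (cb v w); apply.
      by rewrite (connect_trans cvx) // (connect_trans cxy) // e_sym.
    - by have := nw v; rewrite -(same_connect_r e_sym cxy) cvx.
    - by have := nv w; rewrite (same_connect_r e_sym cxy) cwy.
  move=> v; apply: Some_inj; rewrite hE /ext; case: pickP => [w cwv|/(_ v)].
    by congr Some; apply/eqP; move/implyP: (cb w v); apply.
  by rewrite connect0.
rewrite card_imset ?cardsT ?card_ffun.
  by rewrite card_sig; congr (_ ^ _)%N; apply: eq_card => x; rewrite !inE.
move=> g1 g2 /ffunP eqh; apply/ffunP=> x; apply: Some_inj.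
have /andP[xr xi] := valP x.
have Hx g : ext g (val x) = Some (g x).
  rewrite /ext; case: pickP => [v cvx|_]; first by move/forallP/(_ v): xi; rewrite cvx.
  by rewrite (eqP xr) valK.
by rewrite -!Hx -!hE eqh.
Qed.
End Labelings.

(** * The walled Brauer algebra *)

Section Diagrams.
Variables r s : nat.

(** [(false, i)] is the lower vertex and [(true, i)] the upper vertex of index
    [i]; indices are numbered from 0, so the wall is between [r.-1] and [r]. *)
Definition vertex : finType := (bool * 'I_(r + s))%type.
Definition leftOfWall (v : vertex) : bool := (v.2 < r)%N.

(** A perfect matching is encoded by the map exchanging the ends of each edge. *)
Definition isDiagram (f : {ffun vertex -> vertex}) : bool :=
  [forall v, [&& f (f v) == v, f v != v &
     if v.1 == (f v).1 then leftOfWall v != leftOfWall (f v)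
     else leftOfWall v == leftOfWall (f v)]].

Record diagram := Diagram
  { diagram_val :> {ffun vertex -> vertex}; diagram_valP : isDiagram diagram_val }.
HB.instance Definition _ := [isSub for diagram_val].
HB.instance Definition _ := [Finite of diagram by <:].

Let side (v : vertex) : bool := v.1 (+) leftOfWall v.

Lemma isDiagramP (f : {ffun vertex -> vertex}) :
  reflect [/\ involutive f, forall v, f v != v & forall v, side (f v) = ~~ side v]
          (isDiagram f).
Proof.
have E v : (if v.1 == (f v).1 then leftOfWall v != leftOfWall (f v)
     else leftOfWall v == leftOfWall (f v)) = (side (f v) == ~~ side v).
  by rewrite /side; do 2!case: leftOfWall; case: v.1; case: (f v).1.
apply: (iffP forallP) => [H|[fK ff fs] v]; last by rewrite fK eqxx ff E fs eqxx.
by split=> v; have /and3P[/eqP fK ff] := H v; rewrite ?E => // /eqP.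
Qed.

Lemma diagramK (D : diagram) : involutive D.
Proof. by have /isDiagramP[] := diagram_valP D. Qed.
Lemma diagram_neq (D : diagram) v : D v != v.
Proof. by have /isDiagramP[] := diagram_valP D. Qed.
Let diagram_side (D : diagram) v : side (D v) = ~~ side v.
Proof. by have /isDiagramP[] := diagram_valP D. Qed.

(** To concatenate [D1] placed under [D2], take the copy [false] of the vertices
    carrying the edges of [D1], the copy [true] carrying the edges of [D2], and
    join the upper vertices of the former to the lower vertices of the latter. *)
Definition stackEdge (D1 D2 : diagram) (x : bool * vertex) : bool * vertex :=
  (x.1, if x.1 then D2 x.2 else D1 x.2).
Definition stackGlue (x : bool * vertex) : bool * vertex :=
  if x.1 == x.2.1 then x else (~~ x.1, (~~ x.2.1, x.2.2)).
Definition stackRel (D1 D2 : diagram) : rel (bool * vertex) :=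
  glueRel (stackEdge D1 D2) stackGlue.
Definition outer (v : vertex) : bool * vertex := (v.1, v).

Lemma stackEdgeK D1 D2 : involutive (stackEdge D1 D2).
Proof. by case=> -[] v; rewrite /stackEdge /= diagramK. Qed.
Lemma stackEdge_neq D1 D2 x : stackEdge D1 D2 x != x.
Proof.
by case: x => -[] v; apply/eqP=> -[] /eqP; apply/negP; apply: diagram_neq.
Qed.
Lemma stackGlueK : involutive stackGlue.
Proof. by case=> -[] [[] i]. Qed.
Lemma stack_sym D1 D2 : connect_sym (stackRel D1 D2).
Proof. exact: connect_glue_sym (stackEdgeK D1 D2) stackGlueK. Qed.

Lemma stack_partner D1 D2 v : exists w,
  [/\ w != v, connect (stackRel D1 D2) (outer v) (outer w), side w = ~~ side v &
      forall w', connect (stackRel D1 D2) (outer v) (outer w') -> w' = v \/ w' = w].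
Proof.
have Gout w : stackGlue (outer w) = outer w by rewrite /stackGlue eqxx.
have eM x : side (stackEdge D1 D2 x).2 = ~~ side x.2.
  by case: x => -[] w; rewrite /= diagram_side.
have eG x : stackGlue x != x -> side (stackGlue x).2 = ~~ side x.2.
  by case: x => -[] [[] i]; rewrite /stackGlue ?eqxx //= /side /leftOfWall /=; case: (_ < _)%N.
have [[c w] [wv Gw cw ew uw]] := glue_partner (stackEdgeK D1 D2)
  (@stackEdge_neq D1 D2) stackGlueK eM eG (Gout v).
have Ew : (c, w) = outer w.
  by move: Gw; rewrite /stackGlue /outer; case: eqP => [/= ->//|_ []]; case: (c).
exists w; split=> //.
- by apply: contraNneq wv => <-; apply/eqP.
- by rewrite -Ew.
- by move=> w' /uw /(_ (Gout w'))[[_]|[_]]; [left|right].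
Qed.

Definition composeFun (D1 D2 : diagram) (v : vertex) : vertex :=
  odflt v [pick w | (w != v) && connect (stackRel D1 D2) (outer v) (outer w)].

Lemma composeFunP D1 D2 v :
  [/\ composeFun D1 D2 v != v,
      connect (stackRel D1 D2) (outer v) (outer (composeFun D1 D2 v)),
      side (composeFun D1 D2 v) = ~~ side v &
      forall w, connect (stackRel D1 D2) (outer v) (outer w) ->
        w = v \/ w = composeFun D1 D2 v].
Proof.
have [w [wv cw sw uw]] := stack_partner D1 D2 v.
suff -> : composeFun D1 D2 v = w by [].
rewrite /composeFun; case: pickP => [x /andP[xv /uw[xv'|//]]|/(_ w)].
  by rewrite xv' eqxx in xv.
by rewrite wv cw.
Qed.

Lemma compose_subproof D1 D2 : isDiagram [ffun v => composeFun D1 D2 v].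
Proof.
apply/isDiagramP; split=> v; rewrite !ffunE; have [nv cv sv uv] := composeFunP D1 D2 v => //.
have [nw cw _ _] := composeFunP D1 D2 (composeFun D1 D2 v).
have [//|E] := uv _ (connect_trans cv cw).
by rewrite E eqxx in nw.
Qed.
Definition compose D1 D2 : diagram := Diagram (compose_subproof D1 D2).

(** The internal cycles are the connected components without outer vertices. *)
Definition loops (D1 D2 : diagram) : nat :=
  n_comp (stackRel D1 D2)
         [pred x | [forall v, ~~ connect (stackRel D1 D2) (outer v) x]].

Lemma idDiagram_subproof : isDiagram [ffun v : vertex => (~~ v.1, v.2)].
Proof.
apply/isDiagramP; split=> -[l i]; rewrite !ffunE //= ?negbK //.
  by apply/eqP=> -[]; case: l.
by rewrite /side addNb.
Qed.
Definition idDiagram : diagram := Diagram idDiagram_subproof.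

(** For adjacent [i] and [j], the generator [tau] exchanging [i] and [j]:
    a transposition if they are on the same side of the wall, and a pair of
    horizontal edges otherwise. *)
Definition tauFun (i j : 'I_(r + s)) (v : vertex) : vertex :=
  (if ((i < r)%N == (j < r)%N) || (v.2 \notin [:: i; j]) then ~~ v.1 else v.1,
   tperm i j v.2).

Lemma tau_subproof i j : i != j -> isDiagram [ffun v => tauFun i j v].
Proof.
move=> neqij; apply/isDiagramP.
split=> -[l k]; rewrite !ffunE /tauFun /side /leftOfWall /= ?tpermK.
- congr (_, _).
  have -> : (tperm i j k \in [:: i; j]) = (k \in [:: i; j]).
    rewrite !inE; case: tpermP => [->|->|/eqP/negPf-> /eqP/negPf->] //;
    by rewrite ?eqxx ?orbT.
  by case: (_ || _); rewrite ?negbK.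
- apply/eqP=> -[]; rewrite !inE; case: tpermP => [->|->|/eqP/negPf-> /eqP/negPf->].
  + by move=> _ /eqP; rewrite eq_sym (negPf neqij).
  + by move=> _ /eqP; rewrite (negPf neqij).
  + by rewrite orbT; case: l.
- rewrite !inE; case: tpermP => [->|->|/eqP/negPf-> /eqP/negPf->]; rewrite ?eqxx ?orbT /= ?addNb //;
  by case: l; do 2!case: (_ < _)%N.
Qed.
Definition tau i j (neqij : i != j) : diagram := Diagram (tau_subproof neqij).

(** Labelling the lower vertices by [I] and the upper vertices by [J], the ends
    of every edge have equal labels. *)
Section Labels.
Variable m : nat.
Implicit Types (I J L : {ffun 'I_(r + s) -> 'I_m}) (D : diagram).

Definition vertexLabel I J (v : vertex) : 'I_m := if v.1 then J v.2 else I v.2.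
Definition compatible D I J : bool :=
  [forall v, vertexLabel I J (D v) == vertexLabel I J v].

Lemma compatible_id I J : compatible idDiagram I J = (J == I).
Proof.
apply/forallP/eqP=> [H|-> -[l i]]; last by rewrite ffunE /vertexLabel /=; case: l.
by apply/ffunP=> i; have /eqP := H (false, i); rewrite ffunE.
Qed.

Lemma compatible_tau i j (neqij : i != j) I J :
  compatible (tau neqij) I J =
  if (i < r)%N == (j < r)%N then J == [ffun k => I (tperm i j k)]
  else [&& I i == I j, J i == J j &
           [forall k, (k \notin [:: i; j]) ==> (J k == I k)]].
Proof.
have tE v : tau neqij v = tauFun i j v by rewrite ffunE.
apply/forallP/idP; case: ifP => Hij.
- move=> H; apply/eqP/ffunP=> k; rewrite ffunE.
  by have /eqP := H (true, k); rewrite tE /tauFun Hij /vertexLabel /=.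
- move=> H; apply/and3P; split.
  + by have := H (false, j); rewrite tE /tauFun Hij /vertexLabel !inE eqxx orbT /= tpermR.
  + by have := H (true, j); rewrite tE /tauFun Hij /vertexLabel !inE eqxx orbT /= tpermR.
  apply/forallP=> k; apply/implyP=> kij; have := H (false, k).
  rewrite tE /tauFun Hij kij /vertexLabel /=.
  move: kij; rewrite !inE negb_or => /andP[ki kj].
  by rewrite tpermD // eq_sym.
- move/eqP=> -> [l k]; rewrite tE /tauFun Hij /vertexLabel /=.
  by case: l; rewrite !ffunE ?tpermK.
- case/and3P=> /eqP Iij /eqP Jij /forallP JI [l k]; rewrite tE /tauFun Hij /vertexLabel /=.
  have := JI k; rewrite !inE; case: tpermP => [->|->|/eqP ki /eqP kj].
  + by rewrite eqxx /= Iij Jij; case: l.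
  + by rewrite eqxx orbT /= Iij Jij; case: l.
  by rewrite (negPf ki) (negPf kj) /= => /eqP->; case: l.
Qed.

Lemma sum_compatible D1 D2 I L :
  (\sum_J compatible D1 I J * compatible D2 J L =
   m ^ loops D1 D2 * compatible (compose D1 D2) I L)%N.
Proof.
set e := stackRel D1 D2.
have -> : compatible (compose D1 D2) I L = consistent e outer (vertexLabel I L).
  apply/forallP/'forall_forallP=> [H v w|H v].
    apply/implyP=> cvw; have [_ _ _ uv] := composeFunP D1 D2 v.
    by have [->//|->] := uv w cvw; have := H v; rewrite ffunE eq_sym.
  have [_ cv _ _] := composeFunP D1 D2 v; rewrite ffunE eq_sym.
  by move/implyP: (H v (composeFun D1 D2 v)); apply.
have := card_labelings outer (vertexLabel I L) (stack_sym D1 D2).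
rewrite card_ord mulnC => <-.
under eq_bigr do rewrite mulnb.
rewrite -big_mkcond /= sum1_card.
pose h J := [ffun x : bool * vertex =>
  if x.1 == x.2.1 then vertexLabel I L x.2 else J x.2.2].
have h_inj : injective h.
  move=> J1 J2 /ffunP eqh; apply/ffunP=> k.
  by have := eqh (false, (true, k)); rewrite !ffunE.
rewrite -(card_imset _ h_inj); apply: eq_card => l.
apply/imsetP/labelingP.
  move=> [J /andP[/forallP H1 /forallP H2] ->]; split; last first.
    by move=> v; rewrite ffunE eqxx.
  have E1 v : h J (false, v) = vertexLabel I J v by rewrite ffunE; case: v => -[].
  have E2 v : h J (true, v) = vertexLabel J L v by rewrite ffunE; case: v => -[].
  suff He x y : e x y -> h J x = h J y.
    move=> x y /connectP[p + ->]; elim: p x => //= z p IHp x /andP[/He-> /IHp].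
    by [].
  case/orP=> /eqP->; case: x => -[] v; rewrite /stackEdge /= ?E1 ?E2.
  + by apply/esym/eqP/H2.
  + by apply/esym/eqP/H1.
  + by case: v => -[] i; rewrite /stackGlue /= ?E1 ?E2.
  + by case: v => -[] i; rewrite /stackGlue /= ?E1 ?E2.
move=> [lc lb]; pose J := [ffun k => l (false, (true, k))].
have lg k : l (true, (false, k)) = l (false, (true, k)).
  by apply/esym/lc/connect1/orP; right; apply/eqP.
have Elow v : l (false, v) = vertexLabel I J v.
  by case: v => -[] k; rewrite /vertexLabel /= ?ffunE // -[RHS](lb (false, k)).
have Eup v : l (true, v) = vertexLabel J L v.
  by case: v => -[] k; rewrite /vertexLabel /= ?ffunE // -[RHS](lb (true, k)).
have le x : l (stackEdge D1 D2 x) = l x.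
  by apply/esym/lc/connect1; rewrite /stackRel /glueRel eqxx.
exists J.
  apply/andP; split; apply/forallP=> v; apply/eqP.
    by rewrite -!Elow -(le (false, v)).
  by rewrite -!Eup -(le (true, v)).
apply/ffunP=> -[[] [[] k]]; rewrite ffunE /= ?ffunE //.
Qed.
End Labels.

Lemma compatible_inj D1 D2 a b :
  (forall m (I L : {ffun 'I_(r + s) -> 'I_m}),
     m ^ a * compatible D1 I L = m ^ b * compatible D2 I L)%N ->
  D1 = D2 /\ a = b.
Proof.
move=> H; have [M EM] : {M | M = #|vertex|} by exists #|vertex|.
pose m := M.+2.
pose c (v : vertex) : 'I_m := inord (minn (enum_rank v) (enum_rank (D1 v))).
have cD v : c (D1 v) = c v by rewrite /c diagramK minnC.
have cinj v w : c v = c w -> w = v \/ w = D1 v.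
  have lt u : (minn (enum_rank u) (enum_rank (D1 u)) < m)%N.
    by rewrite (leq_ltn_trans (geq_minl _ _)) // /m EM (ltn_trans (ltn_ord _)) // ltnW.
  move/(congr1 val); rewrite /= (inordK (lt v)) (inordK (lt w)) => Em.
  move: Em; rewrite /minn; case: ifP => _; case: ifP => _ /ord_inj/enum_rank_inj E.
  - by left.
  - by right; rewrite E diagramK.
  - by right.
  - by left; apply: (inv_inj (diagramK D1)).
pose I := [ffun k => c (false, k)]; pose L := [ffun k => c (true, k)].
have lab v : vertexLabel I L v = c v by case: v => -[] k; rewrite /vertexLabel /= ffunE.
have ok1 : compatible D1 I L by apply/forallP=> v; rewrite !lab cD.
have := H m I L; rewrite ok1 muln1; case ok2: (compatible D2 I L); last first.
  by rewrite muln0 => /eqP; rewrite expn_eq0.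
rewrite muln1 => /expnI-> //; split=> //; apply/val_inj/ffunP=> v.
move/forallP/(_ v): ok2; rewrite !lab => /eqP/esym/cinj[] // /eqP.
by rewrite (negPf (diagram_neq _ _)).
Qed.

Lemma compose_assoc D1 D2 D3 :
  compose D1 (compose D2 D3) = compose (compose D1 D2) D3 /\
  (loops D2 D3 + loops D1 (compose D2 D3) =
   loops D1 D2 + loops (compose D1 D2) D3)%N.
Proof.
apply: compatible_inj => m I L.
have E1 : (m ^ (loops D2 D3 + loops D1 (compose D2 D3)) *
    compatible (compose D1 (compose D2 D3)) I L =
    \sum_J \sum_J' compatible D1 I J * (compatible D2 J J' * compatible D3 J' L))%N.
  under [RHS]eq_bigr => J _ do rewrite -big_distrr /= (sum_compatible D2 D3 J L) mulnCA.
  by rewrite -big_distrr /= (sum_compatible D1 (compose D2 D3) I L) expnD mulnA.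
have E2 : (m ^ (loops D1 D2 + loops (compose D1 D2) D3) *
    compatible (compose (compose D1 D2) D3) I L =
    \sum_J' \sum_J compatible D1 I J * compatible D2 J J' * compatible D3 J' L)%N.
  under [RHS]eq_bigr => J' _ do rewrite -big_distrl /= (sum_compatible D1 D2 I J') -mulnA.
  by rewrite -big_distrr /= (sum_compatible (compose D1 D2) D3 I L) expnD mulnA.
rewrite [LHS]E1 [RHS]E2 exchange_big /=; apply: eq_bigr => J _; apply: eq_bigr => J' _.
by rewrite mulnA.
Qed.

Lemma compose_id_left D : compose idDiagram D = D /\ loops idDiagram D = 0%N.
Proof.
apply: compatible_inj => m I L; rewrite mul1n -[LHS](sum_compatible idDiagram D I L).
rewrite (bigD1 I) //= compatible_id eqxx mul1n big1 ?addn0 // => J /negPf neqJ.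
by rewrite compatible_id neqJ.
Qed.

Lemma compose_id_right D : compose D idDiagram = D /\ loops D idDiagram = 0%N.
Proof.
apply: compatible_inj => m I L; rewrite mul1n -[LHS](sum_compatible D idDiagram I L).
rewrite (bigD1 L) //= compatible_id eqxx muln1 big1 ?addn0 // => J.
by rewrite compatible_id [L == J]eq_sym => /negPf->; rewrite muln0.
Qed.
End Diagrams.

(** The parameter [delta] only enters in the multiplication below. *)
Definition walledBrauer (K : fieldType) (r s : nat) (delta : K) : Type :=
  {ffun diagram r s -> K^o}.

Section Algebra.
Variables (K : fieldType) (r s : nat) (delta : K).
Local Notation walledBrauer := (walledBrauer r s delta).
HB.instance Definition _ := GRing.Lmodule.copy walledBrauer {ffun diagram r s -> K^o}.
Implicit Types (a b c : walledBrauer) (D : diagram r s).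

Definition brauerDiagram D : walledBrauer := [ffun D' => (D' == D)%:R].
Definition brauerMul a b : walledBrauer :=
  \sum_D1 \sum_D2 (a D1 * b D2 * delta ^+ loops D1 D2)
     *: brauerDiagram (compose D1 D2).

Lemma brauer_ext (U : lmodType K) (F : diagram r s -> U) D :
  \sum_D' brauerDiagram D D' *: F D' = F D.
Proof.
rewrite (bigD1 D) //= ffunE eqxx scale1r big1 ?addr0 // => D' /negPf neqD.
by rewrite ffunE neqD scale0r.
Qed.

Lemma brauer_expand a : a = \sum_D a D *: brauerDiagram D.
Proof.
apply/ffunP=> D; rewrite sum_ffunE (bigD1 D) //= !ffunE eqxx.
rewrite big1 ?addr0 ?[_ *: _]mulr1 // => D' neqD.
by rewrite !ffunE eq_sym (negPf neqD) [_ *: _]mulr0.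
Qed.

Lemma brauerMul_ext (U : lmodType K) (F : diagram r s -> U) a b :
  \sum_D brauerMul a b D *: F D =
  \sum_D1 \sum_D2 (a D1 * b D2 * delta ^+ loops D1 D2) *: F (compose D1 D2).
Proof.
under eq_bigr => D _ do rewrite sum_ffunE scaler_suml.
rewrite exchange_big /=; apply: eq_bigr => D1 _.
under eq_bigr => D _ do rewrite sum_ffunE scaler_suml.
rewrite exchange_big /=; apply: eq_bigr => D2 _.
rewrite -[F (compose _ _)]brauer_ext scaler_sumr; apply: eq_bigr => D _.
by rewrite [in LHS]ffunE scalerA.
Qed.

Lemma brauerMulA : associative brauerMul.
Proof.
move=> a b c; pose t D1 D2 D3 : walledBrauer :=
  (a D1 * b D2 * c D3 * delta ^+ (loops D1 D2 + loops (compose D1 D2) D3))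
    *: brauerDiagram (compose (compose D1 D2) D3).
have -> : brauerMul (brauerMul a b) c = \sum_D1 \sum_D2 \sum_D3 t D1 D2 D3.
  pose F D : walledBrauer :=
    \sum_D3 (c D3 * delta ^+ loops D D3) *: brauerDiagram (compose D D3).
  transitivity (\sum_D brauerMul a b D *: F D).
    apply: eq_bigr => D _; rewrite scaler_sumr; apply: eq_bigr => D3 _.
    by rewrite scalerA mulrA.
  rewrite brauerMul_ext; apply: eq_bigr => D1 _; apply: eq_bigr => D2 _.
  rewrite scaler_sumr; apply: eq_bigr => D3 _; rewrite scalerA /t exprD.
  by congr (_ *: _); rewrite mulrACA mulrA.
apply: eq_bigr => D1 _.
pose F D : walledBrauer :=
  (a D1 * delta ^+ loops D1 D) *: brauerDiagram (compose D1 D).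
transitivity (\sum_D brauerMul b c D *: F D).
  by apply: eq_bigr => D _; rewrite scalerA mulrA [brauerMul b c D * _]mulrC.
rewrite brauerMul_ext; apply: eq_bigr => D2 _; apply: eq_bigr => D3 _.
rewrite /F /t; have [<- <-] := compose_assoc D1 D2 D3.
rewrite scalerA exprD; congr (_ *: _).
by rewrite mulrACA [_ * a D1]mulrC !mulrA.
Qed.

Lemma brauerMul1 : left_id (brauerDiagram (idDiagram r s)) brauerMul.
Proof.
move=> a; rewrite [RHS]brauer_expand /brauerMul.
pose F D : walledBrauer :=
  \sum_D2 (a D2 * delta ^+ loops D D2) *: brauerDiagram (compose D D2).
transitivity (\sum_D brauerDiagram (idDiagram r s) D *: F D).
  apply: eq_bigr => D _; rewrite scaler_sumr; apply: eq_bigr => D2 _.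
  by rewrite scalerA mulrA.
rewrite brauer_ext; apply: eq_bigr => D _.
by have [-> ->] := compose_id_left D; rewrite mulr1.
Qed.

Lemma brauerMulr1 : right_id (brauerDiagram (idDiagram r s)) brauerMul.
Proof.
move=> a; rewrite [RHS]brauer_expand; apply: eq_bigr => D _.
pose F D2 : walledBrauer :=
  (a D * delta ^+ loops D D2) *: brauerDiagram (compose D D2).
transitivity (\sum_D2 brauerDiagram (idDiagram r s) D2 *: F D2).
  by apply: eq_bigr => D2 _; rewrite scalerA mulrA [_ * a D]mulrC.
by rewrite brauer_ext /F; have [-> ->] := compose_id_right D; rewrite mulr1.
Qed.

Lemma brauerMulDl : left_distributive brauerMul +%R.
Proof.
move=> a b c; rewrite -big_split; apply: eq_bigr => D1 _.
rewrite -big_split; apply: eq_bigr => D2 _.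
by rewrite ffunE !mulrDl scalerDl.
Qed.

Lemma brauerMulDr : right_distributive brauerMul +%R.
Proof.
move=> a b c; rewrite -big_split; apply: eq_bigr => D1 _.
rewrite -big_split; apply: eq_bigr => D2 _.
by rewrite ffunE mulrDr mulrDl scalerDl.
Qed.

Lemma brauer1_neq0 : brauerDiagram (idDiagram r s) != 0.
Proof.
apply/eqP=> /ffunP/(_ (idDiagram r s)); rewrite !ffunE eqxx => /eqP.
by rewrite oner_eq0.
Qed.

HB.instance Definition _ := GRing.Zmodule_isNzRing.Build walledBrauer
  brauerMulA brauerMul1 brauerMulr1 brauerMulDl brauerMulDr brauer1_neq0.

Lemma brauer_scaleAl (k : K) (a b : walledBrauer) : k *: (a * b) = (k *: a) * b.
Proof.
rewrite scaler_sumr; apply: eq_bigr => D1 _; rewrite scaler_sumr.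
by apply: eq_bigr => D2 _; rewrite scalerA ffunE !mulrA.
Qed.
HB.instance Definition _ :=
  GRing.Lmodule_isLalgebra.Build K walledBrauer brauer_scaleAl.

Lemma brauer_scaleAr (k : K) (a b : walledBrauer) : k *: (a * b) = a * (k *: b).
Proof.
rewrite scaler_sumr; apply: eq_bigr => D1 _; rewrite scaler_sumr.
by apply: eq_bigr => D2 _; rewrite scalerA ffunE -[k *: b D2]/(k * b D2) [a D1 * (k * _)]mulrCA !mulrA.
Qed.
HB.instance Definition _ :=
  GRing.Lalgebra_isAlgebra.Build K walledBrauer brauer_scaleAr.

Lemma brauerDiagramM D1 D2 :
  brauerDiagram D1 * brauerDiagram D2 =
  delta ^+ loops D1 D2 *: brauerDiagram (compose D1 D2).
Proof.
rewrite -[LHS]/(brauerMul _ _) /brauerMul.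
transitivity (\sum_D brauerDiagram D1 D *: \sum_D' brauerDiagram D2 D' *:
    (delta ^+ loops D D' *: brauerDiagram (compose D D'))).
  apply: eq_bigr => D _; rewrite scaler_sumr; apply: eq_bigr => D' _.
  by rewrite !scalerA.
by rewrite !brauer_ext.
Qed.
End Algebra.

(** * The coordinate ring [K[GL(m)] = K[x_ij]_det] *)

Section CoordinateRing.
Variables (K : fieldType) (m : nat).

Definition genericPoly : 'M[{mpoly K[m * m]}]_m :=
  \matrix_(i, j) 'X_(mxvec_index i j).
Definition detPoly : {mpoly K[m * m]} := \det genericPoly.
Definition evalMx (A : 'M[K]_m) (p : {mpoly K[m * m]}) : K :=
  p.@[fun k => mxvec A 0 k].

Lemma evalMx_det (A : 'M[K]_m) : evalMx A detPoly = \det A.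
Proof.
rewrite /evalMx /detPoly -[LHS]/(meval _ _) -det_map_mx; congr (\det _).
by apply/matrixP=> i j; rewrite mxE /= [genericPoly i j]mxE mevalXU mxvecE.
Qed.

Lemma detPoly_neq0 : detPoly != 0.
Proof.
apply/eqP=> d0; have := evalMx_det 1%:M; rewrite d0 det1 /evalMx meval0.
by move/eqP; rewrite eq_sym oner_eq0.
Qed.

Definition isRegular (f : {fraction {mpoly K[m * m]}}) : Prop :=
  exists p k, f = tofrac p / tofrac detPoly ^+ k.

Definition regular : {pred {fraction {mpoly K[m * m]}}} :=
  fun f => `[< isRegular f >].

Let dF_neq0 k : tofrac detPoly ^+ k != 0.
Proof. by rewrite expf_neq0 // tofrac_eq0 detPoly_neq0. Qed.

Lemma regular_closed : subring_closed regular.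
Proof.
split.
- by apply/asboolP; exists 1, 0; rewrite tofrac1 expr0 divr1.
- move=> f g /asboolP[p [k ->]] /asboolP[q [l ->]]; apply/asboolP.
  exists (p * detPoly ^+ l - q * detPoly ^+ k), (k + l)%N.
  rewrite -mulNr addf_div // -exprD; congr (_ / _).
  by rewrite tofracB !tofracM !tofracXn mulNr.
- move=> f g /asboolP[p [k ->]] /asboolP[q [l ->]]; apply/asboolP.
  exists (p * q), (k + l)%N.
  by rewrite mulf_div -exprD tofracM.
Qed.

HB.instance Definition _ := GRing.isSubringClosed.Build _ regular regular_closed.

Record coordGL := CoordGL
  { coordGL_val :> {fraction {mpoly K[m * m]}};
    coordGL_valP : coordGL_val \in regular }.
HB.instance Definition _ := [isSub for coordGL_val].
HB.instance Definition _ := [Choice of coordGL by <:].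
HB.instance Definition _ := [SubChoice_isSubComNzRing of coordGL by <:].

Lemma polyGL_subproof (p : {mpoly K[m * m]}) : tofrac p \in regular.
Proof. by apply/asboolP; exists p, 0; rewrite expr0 divr1. Qed.
Definition polyGL p : coordGL := CoordGL (polyGL_subproof p).

Lemma polyGL_is_zmod_morphism : zmod_morphism polyGL.
Proof. by move=> p q; apply: val_inj; rewrite /= tofracB. Qed.
Lemma polyGL_is_monoid_morphism : monoid_morphism polyGL.
Proof.
split=> [|p q]; apply: val_inj; first exact: tofrac1.
by rewrite /= tofracM.
Qed.
HB.instance Definition _ :=
  GRing.isZmodMorphism.Build {mpoly K[m * m]} coordGL polyGL polyGL_is_zmod_morphism.
HB.instance Definition _ :=
  GRing.isMonoidMorphism.Build {mpoly K[m * m]} coordGL polyGL polyGL_is_monoid_morphism.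

Definition scaleGL (a : K) (f : coordGL) : coordGL := polyGL a%:MP * f.

Lemma scaleGLA a b f : scaleGL a (scaleGL b f) = scaleGL (a * b) f.
Proof. by rewrite /scaleGL mulrA mpolyCM rmorphM. Qed.
Lemma scaleGL1 : left_id 1 scaleGL.
Proof. by move=> f; rewrite /scaleGL mpolyC1 rmorph1 mul1r. Qed.
Lemma scaleGLDr : right_distributive scaleGL +%R.
Proof. by move=> a f g; rewrite /scaleGL mulrDr. Qed.
Lemma scaleGLDl f : {morph scaleGL^~ f : a b / a + b}.
Proof. by move=> a b; rewrite /scaleGL mpolyCD rmorphD mulrDl. Qed.
HB.instance Definition _ :=
  GRing.Zmodule_isLmodule.Build K coordGL scaleGLA scaleGL1 scaleGLDr scaleGLDl.
Lemma scaleGLAl (a : K) (f g : coordGL) : a *: (f * g) = (a *: f) * g.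
Proof. by rewrite /GRing.scale /= /scaleGL mulrA. Qed.
HB.instance Definition _ := GRing.Lmodule_isLalgebra.Build K coordGL scaleGLAl.
HB.instance Definition _ := GRing.Lalgebra_isComAlgebra.Build K coordGL.

Definition genericGL : 'M[coordGL]_m := map_mx polyGL genericPoly.

Lemma detinvGL_subproof : (tofrac detPoly)^-1 \in regular.
Proof. by apply/asboolP; exists 1, 1; rewrite tofrac1 expr1 div1r. Qed.
Definition detinvGL : coordGL := CoordGL detinvGL_subproof.
Definition invGL : 'M[coordGL]_m := detinvGL *: \adj genericGL.

Lemma genericGLV : genericGL *m invGL = 1%:M.
Proof.
rewrite /invGL -scalemxAr mul_mx_adj scale_scalar_mx det_map_mx /=.
congr _%:M; apply: val_inj; rewrite /= mulVf //.
by rewrite tofrac_eq0 detPoly_neq0.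
Qed.

(** The maximal ideal of the functions vanishing at the identity matrix.  Since
    [detPoly] takes the value 1 there, [evalMx 1%:M p] does not depend on the
    way of writing [f] as a fraction [p / det ^+ k]. *)
Definition augIdeal (f : coordGL) : Prop :=
  exists p k, evalMx 1%:M p = 0
    /\ coordGL_val f = tofrac p / tofrac detPoly ^+ k.

Definition augIdealPow (n : nat) (f : coordGL) : Prop :=
  exists N (g : 'I_N -> 'I_n -> coordGL),
    (forall a b, augIdeal (g a b)) /\ f = \sum_(a < N) \prod_(b < n) g a b.

Definition Dist (d : {scalar coordGL}) : Prop :=
  exists n, forall f, augIdealPow n.+1 f -> d f = 0.

End CoordinateRing.

(** * Mixed tensor space *)

Section MixedTensor.
Variables (K : fieldType) (m r s : nat).

Definition multiIndex : finType := {ffun 'I_(r + s) -> 'I_m}.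

(** The mixed tensor space, in the coordinates with respect to the [v_I]. *)
Definition mixedTensor : vectType K := {ffun multiIndex -> K^o}.
Definition tensorBasis (I : multiIndex) : mixedTensor := [ffun J => (J == I)%:R].

(** The right action of a diagram sends [v_I] to the sum of the [v_J] such that
    labelling the lower vertices by [I] and the upper ones by [J] is compatible. *)
Definition diagramAct (v : mixedTensor) (D : diagram r s) : mixedTensor :=
  [ffun J => \sum_I v I * (compatible D I J)%:R].

Definition brauerAct (v : mixedTensor) (b : walledBrauer r s (m%:R : K)) : mixedTensor :=
  \sum_D b D *: diagramAct v D.

Lemma diagramAct_linear D : linear (diagramAct^~ D).
Proof.
move=> k v w; apply/ffunP=> J; rewrite !ffunE scaler_sumr -big_split /=.
by apply: eq_bigr => I _; rewrite !ffunE mulrDl; congr (_ + _); apply/esym/mulrA.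
Qed.

Lemma brauerAct_linear b : linear (brauerAct^~ b).
Proof.
move=> k v w; rewrite scaler_sumr -big_split; apply: eq_bigr => D _.
by rewrite diagramAct_linear scalerDr !scalerA [b D * k]mulrC.
Qed.

Lemma diagramAct_compose v D1 D2 :
  diagramAct (diagramAct v D1) D2 =
  (m%:R : K) ^+ loops D1 D2 *: diagramAct v (compose D1 D2).
Proof.
apply/ffunP=> L; rewrite !ffunE scaler_sumr.
under eq_bigr do rewrite ffunE mulr_suml.
rewrite exchange_big /=; apply: eq_bigr => I _.
under eq_bigr do rewrite -mulrA -natrM.
by rewrite -mulr_sumr -natr_sum sum_compatible natrM natrX [RHS]mulrCA.
Qed.

Lemma brauerAct1 v : brauerAct v 1 = v.
Proof.
rewrite -[1]/(brauerDiagram (m%:R : K) (idDiagram r s)) /brauerAct brauer_ext; apply/ffunP=> J.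
rewrite ffunE (bigD1 J) //= compatible_id eqxx mulr1 big1 ?addr0 // => I /negPf neqI.
by rewrite compatible_id eq_sym neqI mulr0.
Qed.

Lemma brauerActM v a b : brauerAct v (a * b) = brauerAct (brauerAct v a) b.
Proof.
rewrite /brauerAct brauerMul_ext exchange_big; apply: eq_bigr => D2 _ /=.
have -> : diagramAct (\sum_D a D *: diagramAct v D) D2 =
    \sum_D a D *: diagramAct (diagramAct v D) D2.
  have HL : linear (diagramAct^~ D2) by exact: diagramAct_linear.
  pose L := HB.pack_for {linear mixedTensor -> mixedTensor} (diagramAct^~ D2)
    (GRing.isLinear.Build K mixedTensor mixedTensor *:%R (diagramAct^~ D2) HL).
  rewrite -[LHS]/(L _) linear_sum; apply: eq_bigr => D _.
  by rewrite linearZ.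
rewrite scaler_sumr; apply: eq_bigr => D1 _.
by rewrite diagramAct_compose !scalerA [b D2 * _]mulrC.
Qed.

Lemma diagramAct_basis D I J : diagramAct (tensorBasis I) D J = (compatible D I J)%:R.
Proof.
rewrite ffunE (bigD1 I) //= ffunE eqxx mul1r big1 ?addr0 // => I' /negPf neqI.
by rewrite ffunE neqI mul0r.
Qed.

Lemma brauerAct_transposition (i j : 'I_(r + s)) (neqij : i != j) I :
  (i < r)%N = (j < r)%N ->
  brauerAct (tensorBasis I) (brauerDiagram _ (tau neqij)) =
  tensorBasis [ffun k => I (tperm i j k)].
Proof.
move=> Hij; rewrite /brauerAct brauer_ext; apply/ffunP=> J.
by rewrite diagramAct_basis compatible_tau Hij eqxx ffunE.
Qed.

Lemma brauerAct_contraction (i j : 'I_(r + s)) (neqij : i != j) I :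
  (i < r)%N != (j < r)%N ->
  brauerAct (tensorBasis I) (brauerDiagram _ (tau neqij)) =
  (I i == I j)%:R *:
    \sum_(k < m) tensorBasis [ffun l => if l \in [:: i; j] then k else I l].
Proof.
move=> Hij; rewrite /brauerAct brauer_ext; apply/ffunP=> J.
rewrite diagramAct_basis compatible_tau (negPf Hij) ffunE sum_ffunE.
rewrite -mulnb natrM; congr (_ * _).
rewrite (bigD1 (J i)) //= big1 ?addr0.
  rewrite ffunE; congr (nat_of_bool _)%:R; apply/andP/eqP.
    move=> [/eqP Jij /forallP H]; apply/ffunP=> l; rewrite ffunE !inE.
    have := H l; rewrite !inE; case: eqP => [->//|_].
    by case: eqP => [->//|_ /= /eqP].
  move=> EJ; split; first by rewrite [in X in _ == X]EJ ffunE !inE eqxx orbT.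
  apply/forallP=> l; apply/implyP=> /negPf lij.
  by rewrite [in X in X == _]EJ ffunE lij.
move=> k neqk; rewrite ffunE; case: eqP => // EJ; case/eqP: neqk.
by rewrite EJ ffunE inE eqxx.
Qed.

(** [g v_J] is the sum over [I] of the [tensorCoef I J] evaluated at [g], times
    [v_I]; on the factors [W] the group acts by [g v_k^* = \sum_a (g^-1)_ka v_a^*]. *)
Definition tensorCoef (I J : multiIndex) : coordGL K m :=
  \prod_(k < r + s)
    (if (k < r)%N then genericGL K m (I k) (J k) else invGL K m (J k) (I k)).

Definition distAct (d : {scalar coordGL K m}) (v : mixedTensor) : mixedTensor :=
  [ffun I => \sum_J d (tensorCoef I J) * v J].

Lemma distAct_is_linear d : linear (distAct d).
Proof.
move=> k v w; apply/ffunP=> I; rewrite !ffunE scaler_sumr -big_split /=.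
by apply: eq_bigr => J _; rewrite !ffunE mulrDr; congr (_ + _); apply: mulrCA.
Qed.
HB.instance Definition _ d :=
  GRing.isLinear.Build K mixedTensor mixedTensor _ (distAct d) (distAct_is_linear d).

Definition Psi (d : {scalar coordGL K m}) : 'End(mixedTensor) := linfun (distAct d).

Definition rationalSchur (phi : 'End(mixedTensor)) : Prop :=
  exists2 d : {scalar coordGL K m}, Dist d & phi = Psi d.

Definition brauerEnd (phi : 'End(mixedTensor)) : Prop :=
  forall (v : mixedTensor) (b : walledBrauer r s (m%:R : K)),
    phi (brauerAct v b) = brauerAct (phi v) b.
End MixedTensor.

(* Main.v *)
Require Import Defs.
From HB Require Import structures.
From mathcomp Require Import all_boot all_order all_fingroup all_algebra zify.
From mathcomp Require Import mpoly boolp.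
Set Implicit Arguments.
Unset Strict Implicit.
Unset Printing Implicit Defensive.
Import GRing.Theory.
Local Open Scope ring_scope.

(** Write [T I J] for the matrix coefficients of the mixed tensor space and
    [phi I J] for those of [phi].  Distributions commute with diagrams because
    every edge of a diagram contracts an entry of [g] with an entry of [g^-1].

    Conversely, the jets at the identity along lines [1 + eps z] separate regular
    functions, so by duality [phi] comes from a distribution as soon as each
    linear relation [sum a(I,J) T I J = 0] in [K[GL(m)]] implies
    [sum a(I,J) phi(I,J) = 0].  If [phi] commutes with the diagrams, then
    [x_(I,J) y_(I,J) |-> phi(I,J)] is a functional in bidegree [(r, s)] killing
    the ideal of the relations [X Y = Y X = t], where [t] is the common diagonal
    entry.  So one has to see that a form of bidegree [(r, s)] vanishing on all
    pairs [(g, g^-1)] lies in this ideal.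

    For this, take products of [s] maximal minors of [[1 | Y]] and [r] maximal
    minors of [[X | 1]], times the power of [t] giving the bidegree [(r, s)].
    Modulo [X Y = Y X = t] they satisfy the Pluecker relations, also for a minor
    of [[1 | Y]] against one of [[X | 1]]; straightening thus expresses all of
    them by the standard ones.  Substituting [X = adj(B) A], [Y = adj(A) B],
    [t = det A det B] turns them into the products of [s + r] maximal minors of
    [[A | B]], and the standard products of maximal minors of a generic
    [m x 2m] matrix are linearly independent. *)

(** * Exchange relation for pairs of minors *)

Section Exchange.
Variable R : comNzRingType.

(** A permutation contributing to the determinant would send [P] injectively into the complement of
    [Q], which is too small. *)
Lemma det_zero_block n (A : 'M[R]_n) (P Q : {set 'I_n}) :
  (n < #|P| + #|Q|)%N -> (forall i j, i \in P -> j \in Q -> A i j = 0) ->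
  \det A = 0.
Proof.
move=> ltn A0; apply: big1 => s _.
have : s @: P :&: Q != set0.
  apply: contraTneq ltn => /eqP; rewrite setI_eq0 => dPQ; rewrite -leqNgt.
  rewrite -(card_imset P (@perm_inj _ s)) -cardsUI (disjoint_setI0 dPQ) cards0 addn0.
  by rewrite -[leqRHS]card_ord max_card.
case/set0Pn=> j /setIP[/imsetP[i Pi ->] Qsi].
by rewrite (bigD1 i) //= A0 // mul0r mulr0.
Qed.

Lemma det_zero_col n (A : 'M[R]_n) j : (forall i, A i j = 0) -> \det A = 0.
Proof.
move=> Aj; apply: (det_zero_block (P := setT) (Q := [set j])) => [|i k _ /set1P->//].
by rewrite cardsT card_ord cards1 addn1.
Qed.

(** Laplace expansion along the rows in [top]: each permutation survives for exactly one [S], the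
    set of columns it assigns to these rows. *)
Lemma det_laplace n (top : pred 'I_n) (A : 'M[R]_n) :
  \det A = \sum_(S : {set 'I_n}) \det (\matrix_(i, j) (A i j *+ (top i == (j \in S)))).
Proof.
rewrite /determinant exchange_big /=; apply: eq_bigr => s _; rewrite -mulr_sumr.
congr (_ * _); rewrite (bigD1 [set s i | i in top]) //= [X in _ + X]big1 ?addr0.
  apply: eq_bigr => i _; rewrite mxE mem_imset ?eqxx //; exact: perm_inj.
move=> S /eqP neqS; have [/forallP HS|/forallPn[i Hi]] :=
  boolP [forall i, top i == (s i \in S)]; last first.
  by rewrite (bigD1 i) //= mxE (negPf Hi) mulr0n mul0r.
case: neqS; apply/setP=> j; rewrite -(permKV s j) mem_imset; last exact: perm_inj.
by rewrite -(eqP (HS _)).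
Qed.

Lemma imset_perm_exists (T : finType) (A B : {set T}) :
  #|A| = #|B| -> exists s : {perm T}, s @: A = B.
Proof.
move=> cAB; pose e (C : {set T}) := enum C ++ enum (~: C).
have eu C : uniq (e C).
  rewrite cat_uniq !enum_uniq /= andbT; apply/hasPn=> x.
  by rewrite !mem_enum inE.
have eT C x : x \in e C by rewrite mem_cat !mem_enum inE orbN.
have es C : size (e C) = #|T| by rewrite size_cat -!cardE cardsC.
pose f x := nth x (e B) (index x (e A)).
have ltf x : (index x (e A) < size (e B))%N by rewrite es -(es A) index_mem.
have finj : injective f.
  move=> x y; rewrite /f (set_nth_default y _ (ltf x)) => /eqP.
  by rewrite nth_uniq // => /eqP /(congr1 (nth x (e A))); rewrite !nth_index.
exists (perm finj); apply/eqP; rewrite eqEcard card_imset ?cAB ?leqnn ?andbT; last exact: perm_inj.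
apply/subsetP=> _ /imsetP[x Ax ->]; rewrite permE /f index_cat mem_enum Ax nth_cat.
have lt : (index x (enum A) < size (enum B))%N.
  by rewrite -!cardE -cAB cardE index_mem mem_enum.
by rewrite lt -mem_enum mem_nth.
Qed.

(** Permuting the columns by [s] brings those of the chosen set to the front, and the masked matrix
    becomes block diagonal. *)
Lemma det_laplace_term m (A : 'M[R]_(m + m)) (s : {perm 'I_(m + m)}) :
  \det (\matrix_(i, j) (A i j *+ ((i < m)%N == (j \in [set s k | k : 'I_(m + m) & (k < m)%N]))))
  = (-1) ^+ s * (\det (\matrix_(i, j) A (lshift m i) (s (lshift m j)))
               * \det (\matrix_(i, j) A (rshift m i) (s (rshift m j)))).
Proof.
set B := \matrix_(i, j) _; have -> : \det B = (-1) ^+ s * \det (col_perm s B).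
  rewrite col_permE det_mulmx det_perm odd_permV mulrCA -signr_addb addbb expr0.
  by rewrite mulr1.
congr (_ * _).
have HE i k : B i (s k) = A i (s k) *+ ((i < m)%N == (k < m)%N).
  by rewrite mxE mem_imset ?inE //; apply: perm_inj.
have -> : col_perm s B = block_mx (\matrix_(i, j) A (lshift m i) (s (lshift m j))) 0 0
   (\matrix_(i, j) A (rshift m i) (s (rshift m j))).
  apply/matrixP=> i j; rewrite mxE HE.
  case: (split_ordP i) => i' ->; case: (split_ordP j) => j' ->.
  - by rewrite block_mxEul mxE.
  - by rewrite block_mxEur mxE.
  - by rewrite block_mxEdl mxE.
  - by rewrite block_mxEdr mxE.
by rewrite det_ublock.
Qed.

(* The [moved] columns, those outside [F1] and [F2], are more than [m] vectors of
   [R^m], up to the linear map [L]; hence the alternating sum over the ways of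
   sharing them between the two determinants vanishes. *)
Lemma det_exchange m (N1 N2 : 'M[R]_(m, m + m)) (L : 'M[R]_m) (F1 F2 : {set 'I_(m + m)})
    (V : R -> Prop) (c : R) :
  V 0 -> (forall x y, V x -> V y -> V (x - y)) ->
  (forall j, j \in F1 -> (j < m)%N) -> (forall j, j \in F2 -> (m <= j)%N) ->
  (#|F1| + #|F2| < m)%N ->
  (forall j, j \notin F1 -> j \notin F2 -> col j N2 = L *m col j N1) \/
  (forall j, j \notin F1 -> j \notin F2 -> col j N1 = L *m col j N2) ->
  (forall s : {perm 'I_(m + m)},
     (exists2 j : 'I_m, True & (m <= s (lshift m j))%N) ->
     (forall j, s (rshift m j) \notin F1) -> (forall j, s (lshift m j) \notin F2) ->
     V (c * (\det (colsub (fun j => s (lshift m j)) N1) *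
             \det (colsub (fun j => s (rshift m j)) N2)))) ->
  V (c * (\det (lsubmx N1) * \det (rsubmx N2))).
Proof.
move=> V0 VB F1m F2m ltF HL HV.
have VN x : V x -> V (- x) by move=> Vx; rewrite -sub0r; apply: VB.
have VD x y : V x -> V y -> V (x + y).
  by move=> Vx Vy; rewrite -[y]opprK; apply: VB => //; apply: VN.
(* The masking lets the columns in [F1] be used by the top rows only, and those in [F2] by the
   bottom rows only. *)
pose Mt : 'M[R]_(m, m + m) := \matrix_(i, j) (N1 i j *+ (j \notin F2)).
pose Mb : 'M[R]_(m, m + m) := \matrix_(i, j) (N2 i j *+ (j \notin F1)).
pose M : 'M_(m + m) := col_mx Mt Mb.
have cmv : (m < #|~: (F1 :|: F2)|)%N.
  have := cardsC (F1 :|: F2); rewrite card_ord => cE.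
  have : (#|F1 :|: F2| <= #|F1| + #|F2|)%N by rewrite -cardsUI leq_addr.
  by lia.
have ctop : #|[set i : 'I_(m + m) | (i < m)%N]| = m.
  rewrite -[RHS]card_ord -cardsT -(card_imset _ (@lshift_inj m m)).
  apply: eq_card => i; rewrite inE; apply/idP/imsetP => [ltim|[j _ ->] /=]; last exact: ltn_ord.
  by exists (Ordinal ltim); last apply: val_inj.
(* A row operation with [L] clears one of the two row blocks on all moved columns, which leaves too
   large a block of zeros. *)
have detM : \det M = 0.
  case: HL => HL.
  - have : \det (block_mx 1%:M 0 (- L) 1%:M *m M) = 0.
      rewrite mul_block_col !mul1mx mul0mx addr0.
      apply: (det_zero_block (P := ~: [set i : 'I_(m + m) | (i < m)%N])
                             (Q := ~: (F1 :|: F2))).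
        have := cardsC [set i : 'I_(m + m) | (i < m)%N]; rewrite ctop card_ord.
        by move: cmv; set c1 := #|pred_of_set (~: (F1 :|: F2))|; set c2 := #|_|; lia.
      move=> i j; rewrite !inE -leqNgt => lemi /norP[jF1 jF2].
      case: (split_ordP i) lemi => i' -> lemi; first by move: lemi; rewrite /= leqNgt ltn_ord.
      rewrite col_mxEd mulNmx !mxE jF1 mulr1n.
      have /matrixP/(_ i' 0) := HL j jF1 jF2; rewrite !mxE => ->.
      rewrite addrC; apply/eqP; rewrite subr_eq0; apply/eqP/eq_bigr => k _.
      by rewrite !mxE jF2 mulr1n.
    by rewrite det_mulmx det_lblock !det1 !mul1r.
  - have : \det (block_mx 1%:M (- L) 0 1%:M *m M) = 0.
      rewrite mul_block_col !mul1mx mul0mx add0r.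
      apply: (det_zero_block (P := [set i : 'I_(m + m) | (i < m)%N])
                             (Q := ~: (F1 :|: F2))).
        by rewrite ctop ltn_add2l.
      move=> i j; rewrite !inE => ltim /norP[jF1 jF2].
      case: (split_ordP i) ltim => i' -> ltim; last by [].
      rewrite col_mxEu mulNmx !mxE jF2 mulr1n.
      have /matrixP/(_ i' 0) := HL j jF1 jF2; rewrite !mxE => ->.
      apply/eqP; rewrite subr_eq0; apply/eqP/eq_bigr => k _.
      by rewrite !mxE jF1 mulr1n.
    by rewrite det_mulmx det_ublock !det1 !mul1r.
pose top := [pred i : 'I_(m + m) | (i < m)%N].
pose MS (S : {set 'I_(m + m)}) := \matrix_(i, j) (M i j *+ (top i == (j \in S))).
pose S0 := [set i : 'I_(m + m) | (i < m)%N].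
(* In the expansion of this vanishing determinant the term of [S0] is the product sought; every
   other term is zero or, up to sign, one of the products assumed to lie in [V]. *)
move: detM; rewrite (det_laplace top) (bigD1 S0) //=.
have -> : \det (\matrix_(i, j) (M i j *+ (top i == (j \in S0)))) =
    \det (lsubmx N1) * \det (rsubmx N2).
  have -> : S0 = [set (1%g : {perm 'I_(m + m)}) k | k : 'I_(m + m) & (k < m)%N].
    by apply/setP=> k; rewrite -{2}[k](perm1 k) mem_imset ?inE //; apply: perm_inj.
  rewrite det_laplace_term odd_perm1 expr0 mul1r. congr (_ * _); congr (\det _).
    apply/matrixP=> i j; rewrite mxE [RHS]mxE perm1 /M col_mxEu mxE.
    case: (boolP (_ \in F2)) => //= /F2m /=; by rewrite leqNgt ltn_ord.
  apply/matrixP=> i j; rewrite mxE [RHS]mxE perm1 /M col_mxEd mxE.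
  case: (boolP (_ \in F1)) => //= /F1m /=; by rewrite ltnNge leq_addr.
move/eqP; rewrite addr_eq0 => /eqP->; rewrite mulrN mulr_sumr; apply: (VN).
apply: big_ind => // S neqS; rewrite -[\det _]/(\det (MS S)).
have [FS1|] := boolP (F1 \subset S); last first.
  case/subsetPn=> j jF1 jS; rewrite (det_zero_col (j := j)) ?mulr0 // => i.
  rewrite mxE (negPf jS) eqbF_neg /=; case: (split_ordP i) => i' ->.
    by rewrite mulr0n.
  by rewrite /M col_mxEd mxE jF1 mulr0n mul0rn.
have [FS2|] := boolP [disjoint F2 & S]; last first.
  move/pred0Pn=> [j /andP[/= jF2 jS]]; rewrite (det_zero_col (j := j)) ?mulr0 // => i.
  rewrite mxE jS eqb_id /=; case: (split_ordP i) => i' ->.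
    by rewrite /M col_mxEu mxE jF2 mulr0n mul0rn.
  by rewrite mulr0n.
have [cS|cS] := eqVneq #|S| m; last first.
  have [ltS|gtS|eqS] := ltngtP #|S| m; last by rewrite eqS eqxx in cS.
  - rewrite (det_zero_block (P := S0) (Q := ~: S)) ?mulr0 //.
      by move: (cardsC S) ltS; rewrite ctop card_ord; set c1 := #|pred_of_set (~: S)|; set c2 := #|_|; lia.
    by move=> i j; rewrite !inE mxE => /= -> /negPf->.
  - rewrite (det_zero_block (P := ~: S0) (Q := S)) ?mulr0 //.
      by move: (cardsC S0) gtS; rewrite ctop card_ord; set c1 := #|pred_of_set (~: S0)|; set c2 := #|_|; lia.
    by move=> i j; rewrite !inE mxE => /= /negPf-> ->.
have [s sS] : exists s : {perm 'I_(m + m)}, s @: S0 = S.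
  by apply: imset_perm_exists; rewrite ctop cS.
have ES : S = [set s k | k : 'I_(m + m) & (k < m)%N].
  by rewrite -sS; apply/setP=> k; apply/imsetP/imsetP=> -[k' + ->]; rewrite inE => ?;
    exists k'; rewrite ?inE.
have memS k : (s k \in S) = (k < m)%N.
  by rewrite -sS mem_imset ?inE //; apply: perm_inj.
have lF2 j : s (lshift m j) \notin F2.
  by apply/negP=> /(disjointFr FS2); rewrite memS /= ltn_ord.
have rF1 j : s (rshift m j) \notin F1.
  by apply/negP=> /(subsetP FS1); rewrite memS /= ltnNge leq_addr.
have -> : \det (MS S) = (-1) ^+ s *
    (\det (colsub (fun j => s (lshift m j)) N1) * \det (colsub (fun j => s (rshift m j)) N2)).
  rewrite /MS ES det_laplace_term; congr (_ * _); congr (_ * _); congr (\det _).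
    by apply/matrixP=> i j; rewrite mxE [RHS]mxE /M col_mxEu mxE lF2.
  by apply/matrixP=> i j; rewrite mxE [RHS]mxE /M col_mxEd mxE rF1.
rewrite mulrCA; suff Vs : V (c * (\det (colsub (fun j => s (lshift m j)) N1) *
             \det (colsub (fun j => s (rshift m j)) N2))).
  by case: odd_perm; rewrite ?expr0 ?mul1r // expr1 mulN1r; apply: VN.
apply: HV => //; have [/forallP H|/forallPn[j Hj]] :=
    boolP [forall j, (s (lshift m j) < m)%N]; last by exists j; rewrite // leqNgt.
case/negP: neqS; rewrite eqEcard ctop cS leqnn andbT -sS.
apply/subsetP=> _ /imsetP[k + ->]; rewrite !inE => ltkm.
by have := H (Ordinal ltkm); rewrite (_ : lshift _ _ = k) //; apply: val_inj.
Qed.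
End Exchange.

(** * Straightening *)

Lemma det_scale (R : comNzRingType) n (A : 'M[R]_n) (t : R) (e : 'I_n -> nat) :
  \det (\matrix_(k, l) (A k l * t ^+ e l)) = \det A * t ^+ (\sum_l e l)%N.
Proof.
rewrite (_ : (\matrix_(k, l) _) = A *m diag_mx (\row_l t ^+ e l)); last first.
  by apply/matrixP=> k l; rewrite mul_mx_diag !mxE.
rewrite det_mulmx det_diag; congr (_ * _).
by rewrite -prodrXr; apply: eq_bigr => l _; rewrite mxE.
Qed.

Section Straightening.
Variables (R : comNzRingType) (m r s : nat) (X Y : 'M[R]_m) (t : R).
Hypotheses (XY : X *m Y = t%:M) (YX : Y *m X = t%:M).

Local Notation column := {ffun 'I_m -> 'I_(m + m)}.
Local Notation tableau := {ffun 'I_(s + r) -> column}.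

(** For a minor of [[X | 1]] this is the degree in [X]; for a minor of [[1 | Y]] the degree in [Y]
    is [m] minus this number. *)
Definition nbLow m (al : {ffun 'I_m -> 'I_(m + m)}) : nat := \sum_l (al l < m)%N.

Definition graphMx (a : 'I_(s + r)) : 'M[R]_(m, m + m) :=
  if (a < s)%N then row_mx 1%:M Y else row_mx X 1%:M.
Definition tabMinor (a : 'I_(s + r)) (al : 'I_m -> 'I_(m + m)) : R :=
  \det (colsub al (graphMx a)).
Definition xDegree (T : tableau) : nat := \sum_(a : 'I_(s + r) | (s <= a)%N) nbLow (T a).
(* The exponent of [t] is the one making the value of bidegree [(r, s)], provided that
   [xDegree T <= r]. *)
Definition tabValue (T : tableau) : R :=
  t ^+ (r - xDegree T) * \prod_a tabMinor a (T a).

Definition tabIncr (T : tableau) : bool :=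
  [forall a, forall i : 'I_m, forall j : 'I_m, (i < j)%N ==> (T a i < T a j)%N].
Definition tabStandard (T : tableau) : bool :=
  tabIncr T &&
  [forall a : 'I_(s + r), forall b : 'I_(s + r), forall i, (a < b)%N ==> (T a i <= T b i)%N].

(** The measure on which straightening terminates: earlier factors weigh more, so moving small
    entries to the left lowers it. *)
Definition tabWeight (T : tableau) : nat := \sum_(a < s + r) (s + r - a) * \sum_i T a i.

Lemma tabMinor_perm a al (p : 'S_m) :
  tabMinor a (fun i => al (p i)) = (-1) ^+ p * tabMinor a al.
Proof.
rewrite /tabMinor (_ : colsub _ _ = col_perm p (colsub al (graphMx a))); last first.
  by apply/matrixP=> i j; rewrite !mxE.
by rewrite col_permE det_mulmx det_perm odd_permV mulrC.
Qed.

Lemma tabMinor_repeat a al (i j : 'I_m) : i != j -> al i = al j -> tabMinor a al = 0.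
Proof.
move=> neqij E; rewrite /tabMinor -det_tr; apply: (determinant_alternate neqij) => k.
by rewrite !mxE E.
Qed.

Lemma sort_column (al : column) : injective al ->
  exists p : 'S_m, forall i j : 'I_m, (i < j)%N -> (al (p i) < al (p j))%N.
Proof.
move=> al_inj; pose u := [tuple al i | i < m].
pose v := [tuple of sort (fun x y : 'I_(m + m) => x <= y)%N u].
have /tuple_permP[p Ep] : perm_eq v u by rewrite perm_sort.
have Ev i : tnth v i = al (p i).
  have -> : v = [tuple tnth u (p i) | i < m] by apply: val_inj.
  by rewrite !tnth_mktuple.
exists p => i j ltij; rewrite ltn_neqAle; apply/andP; split.
  by apply/eqP=> /val_inj/al_inj/perm_inj E; rewrite E ltnn in ltij.
rewrite -!Ev !(tnth_nth (al i)).
apply: (sorted_leq_nth (leT := fun x y : 'I_(m + m) => (x <= y)%N)).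
- by move=> x y z; apply: leq_trans.
- by move=> x; apply: leqnn.
- by apply: sort_sorted => x y; apply: leq_total.
- by rewrite inE size_tuple.
- by rewrite inE size_tuple.
- exact: ltnW.
Qed.

Section Step.
Variables (T : tableau) (a b : 'I_(s + r)) (i : 'I_m).
Hypotheses (T_incr : tabIncr T) (ltab : (a < b)%N) (viol : (T b i < T a i)%N)
  (T_adm : (xDegree T <= r)%N).

(** At a violation in row [i], the entries of [T a] from row [i] on and those of [T b] up to row [i]
    are exchanged, [m + 1] in all; [F1] and [F2] are the positions that stay. As the columns
    increase, each moved entry of [T b] is smaller than each moved entry of [T a]. *)
Let P (k : 'I_(m + m)) : 'I_(m + m) :=
  match split k with inl l => T a l | inr l => T b l end.
Let F1 : {set 'I_(m + m)} := [set k : 'I_(m + m) | (k < i)%N].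
Let F2 : {set 'I_(m + m)} := [set k : 'I_(m + m) | (m + i < k)%N].
Let newTab (p : 'S_(m + m)) : tableau :=
  [ffun c => if c == a then [ffun l => P (p (lshift m l))]
             else if c == b then [ffun l => P (p (rshift m l))] else T c].

Let Pl l : P (lshift m l) = T a l.
Proof. by rewrite /P (unsplitK (inl l)). Qed.
Let Pr l : P (rshift m l) = T b l.
Proof. by rewrite /P (unsplitK (inr l)). Qed.

Let incr c (k l : 'I_m) : (k <= l)%N -> (T c k <= T c l)%N.
Proof.
rewrite leq_eqVlt => /predU1P[/val_inj->//|ltkl]; apply: ltnW.
by move/forallP/(_ c)/forallP/(_ k)/forallP/(_ l)/implyP: T_incr; apply.
Qed.

Let neqab : b == a = false.
Proof. by apply/eqP=> E; move: ltab; rewrite E ltnn. Qed.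

Section Perm.
Variable p : 'S_(m + m).
Hypotheses (pF1 : forall j, p (rshift m j) \notin F1)
           (pF2 : forall j, p (lshift m j) \notin F2).

Let sum_lr (f : 'I_(m + m) -> nat) :
  (\sum_l f (p (lshift m l)) + \sum_l f (p (rshift m l)) =
   \sum_l f (lshift m l) + \sum_l f (rshift m l))%N.
Proof.
have Hf (g : 'I_(m + m) -> nat) :
    (\sum_l g (lshift m l) + \sum_l g (rshift m l) = \sum_k g k)%N by rewrite big_split_ord.
rewrite (Hf (fun k => f (p k))) Hf [RHS](reindex_inj (@perm_inj _ p)) //.
Qed.

Let sum_l (f : 'I_(m + m) -> nat) :
  (\sum_l f (p (lshift m l)) = \sum_(k < m + m) f k * (p^-1%g k < m))%N.
Proof.
rewrite [RHS](reindex_inj (@perm_inj _ p)) /= big_split_ord /= [X in (_ = _ + X)%N]big1 ?addn0.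
  by apply: eq_bigr => l _; rewrite permK /= ltn_ord muln1.
by move=> l _; rewrite permK /= ltnNge leq_addr muln0.
Qed.

Let sum_l0 (f : 'I_(m + m) -> nat) :
  (\sum_l f (lshift m l) = \sum_(k < m + m) f k * (k < m))%N.
Proof.
rewrite big_split_ord /= [X in (_ = _ + X)%N]big1 ?addn0.
  by apply: eq_bigr => l _; rewrite ltn_ord muln1.
by move=> l _; rewrite ltnNge leq_addr muln0.
Qed.

(** The entries arriving on the left are below [T a i] and those leaving are not, so the left column
    sum drops. The sum over both columns is constant, and the left one has the larger factor. *)
Lemma newTab_weight (j : 'I_m) : (m <= p (lshift m j))%N ->
  (tabWeight (newTab p) < tabWeight T)%N.
Proof.
move=> lemj; pose x := T a i; pose w (al : column) := (\sum_l al l)%N.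
pose inl1 (k : 'I_(m + m)) : bool := (p^-1%g k < m)%N.
have low k : inl1 k -> (m <= k)%N -> (P k < x)%N.
  move=> k1 lemk; have := pF2 (Ordinal k1).
  rewrite (_ : lshift _ _ = p^-1%g k) ?permKV; last exact: val_inj.
  case: (split_ordP k) lemk => l -> lemk; first by move: lemk; rewrite /= leqNgt ltn_ord.
  rewrite inE /= ltn_add2l -leqNgt Pr => leli.
  by apply: leq_ltn_trans viol; apply: incr.
have high k : ~~ inl1 k -> (k < m)%N -> (x <= P k)%N.
  rewrite /inl1; case: (split_ordP (p^-1%g k)) => l Ek //= _.
  have := pF1 l; rewrite -Ek permKV inE -leqNgt.
  case: (split_ordP k) => l' -> //= leil _.
  by rewrite Pl; apply: incr.
(* Comparing every entry with the threshold [x] makes the inequality termwise; it is strict at the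
   position that [p] brings in from the right. *)
have ptw k : (P k * inl1 k + x * (k < m) <= P k * (k < m) + x * inl1 k)%N.
  have := low k; have := high k.
  by case: (inl1 k); case: ltnP => //= H1 H2 H3; rewrite ?muln1 ?muln0 ?addn0 ?add0n // ?H2 // ltnW // H3.
have Ex : (\sum_(k < m + m) x * (k < m) = \sum_(k < m + m) x * inl1 k)%N.
  by rewrite -(sum_l (fun=> x : nat)) -(sum_l0 (fun=> x : nat)).
have wl : (\sum_l P (p (lshift m l)) < w (T a))%N.
  rewrite (sum_l (fun k => P k)) /w.
  under [X in (_ < X)%N]eq_bigr do rewrite -Pl.
  rewrite (sum_l0 (fun k => P k)) -(ltn_add2r (\sum_(k < m + m) x * (k < m))%N) {2}Ex -!big_split /=.
  rewrite (bigD1 (p (lshift m j))) //= [X in (_ < X)%N](bigD1 (p (lshift m j))) //=.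
  rewrite -addSn; apply: leq_add; last by apply: leq_sum => k _; apply: ptw.
  have k1 : inl1 (p (lshift m j)) by rewrite /inl1 permK /= ltn_ord.
  have := low _ k1 lemj; rewrite -/(inl1 _) k1 [(p _ < m)%N]ltnNge lemj /=.
  by rewrite !muln0 !muln1 addn0 add0n.
have wlr := sum_lr (fun k => P k).
have Ewa : (\sum_l P (lshift m l) = w (T a))%N by apply: eq_bigr => l _; rewrite Pl.
have Ewb : (\sum_l P (rshift m l) = w (T b))%N by apply: eq_bigr => l _; rewrite Pr.
rewrite /tabWeight (bigD1 a) //= [X in (_ < X)%N](bigD1 a) //=.
rewrite (bigD1 b) ?neqab //= [X in (_ < _ + X)%N](bigD1 b) ?neqab //=.
rewrite [X in (_ + (_ + X) < _)%N](_ : _ =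
  \sum_(c < s + r | (c != a) && (c != b)) (s + r - c) * \sum_l T c l)%N; last first.
  by apply: eq_bigr => c /andP[/negPf ca /negPf cb]; rewrite ffunE ca cb.
rewrite !addnA ltn_add2r !ffunE eqxx neqab eqxx.
under eq_bigr do rewrite ffunE; under [X in (_ + _ * X < _)%N]eq_bigr do rewrite ffunE.
move: wlr wl; rewrite Ewa Ewb -/(w (T a)) -/(w (T b)).
have := ltn_ord a; have := ltn_ord b.
move: (w _) (w _) (\sum_l P (p (lshift m l)))%N (\sum_l P (p (rshift m l)))%N => u v u' v'.
move: ltab; set A := nat_of_ord a; set B := nat_of_ord b => *.
have -> : (s + r - A = (B - A) + (s + r - B))%N by lia.
nia.
Qed.

Local Notation lowl := (\sum_l (P (p (lshift m l)) < m)%N)%N.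
Local Notation lowr := (\sum_l (P (p (rshift m l)) < m)%N)%N.

Lemma low_lr : (lowl + lowr = nbLow (T a) + nbLow (T b))%N.
Proof.
rewrite (sum_lr (fun k => (P k < m)%N)) /nbLow.
by congr (_ + _)%N; apply: eq_bigr => l _; rewrite ?Pl ?Pr.
Qed.

Let newTab_nbLow c : nbLow (newTab p c) =
  if c == a then lowl else if c == b then lowr else nbLow (T c).
Proof.
rewrite /nbLow ffunE; case: eqP => _; first by apply: eq_bigr => l _; rewrite ffunE.
by case: eqP => _ //; apply: eq_bigr => l _; rewrite ffunE.
Qed.

Lemma newTab_total : (\sum_c nbLow (newTab p c) = \sum_c nbLow (T c))%N.
Proof.
rewrite (bigD1 a) // (bigD1 b) ?neqab //= [RHS](bigD1 a) // [in RHS](bigD1 b) ?neqab //=.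
rewrite !newTab_nbLow eqxx neqab eqxx !addnA low_lr; congr (_ + _)%N.
by apply: eq_bigr => c /andP[/negPf ca /negPf cb]; rewrite newTab_nbLow ca cb.
Qed.

Lemma newTab_xDegree :
  (xDegree (newTab p) + ((s <= a) * nbLow (T a) + (s <= b) * nbLow (T b)) =
   xDegree T + ((s <= a) * lowl + (s <= b) * lowr))%N.
Proof.
have xE U : (xDegree U = \sum_(c < s + r) (s <= c) * nbLow (U c))%N.
  by rewrite /xDegree big_mkcond; apply: eq_bigr => c _; case: leqP; rewrite ?mul1n ?mul0n.
rewrite !xE (bigD1 a) // (bigD1 b) ?neqab //= [in RHS](bigD1 a) // [in RHS](bigD1 b) ?neqab //=.
rewrite !newTab_nbLow eqxx neqab eqxx.
rewrite [X in (_ + (_ + X) + _)%N](_ : _ =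
  \sum_(c < s + r | (c != a) && (c != b)) (s <= c) * nbLow (T c))%N; last first.
  by apply: eq_bigr => c /andP[/negPf ca /negPf cb]; rewrite newTab_nbLow ca cb.
move: (_ * lowl)%N (_ * lowr)%N (_ * nbLow (T a))%N (_ * nbLow (T b))%N => u v w z.
by move: (bigop _ _ _) => x; lia.
Qed.

(* If the exchanged entries of [T b] are all low, every high entry of [T b] stays. *)
Lemma low_right : (T b i < m)%N ->
  (\sum_l ((p (rshift m l) \notin F2) && (m <= P (p (rshift m l)))) + lowr = nbLow (T b))%N.
Proof.
move=> Tbi; pose g (k : 'I_(m + m)) : nat := (k \in F2) && (m <= P k)%N.
have gr : (\sum_l g (p (rshift m l)) = \sum_l (m <= T b l))%N.
  have := sum_lr g; rewrite big1 ?add0n => [->|l _]; last by rewrite /g (negPf (pF2 l)).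
  rewrite big1 ?add0n => [|l _].
    apply: eq_bigr => l _; rewrite /g inE /= ltn_add2l Pr.
    by case: ltnP => //= leli; rewrite leqNgt (leq_ltn_trans (incr b leli) Tbi).
  by rewrite /g inE /= ltnNge (leq_trans (ltnW (ltn_ord l)) (leq_addr _ _)).
have mE U : (\sum_(l < m) (U l < m) + \sum_(l < m) (m <= U l) = m)%N.
  rewrite -big_split /= -[RHS]card_ord -sum1_card; apply: eq_bigr => l _.
  by case: ltnP.
have := mE (fun l => T b l); rewrite -gr -/(nbLow (T b)).
have := mE (fun l => P (p (rshift m l))); rewrite /=.
have -> : (\sum_l (m <= P (p (rshift m l))) =
  \sum_l g (p (rshift m l)) + \sum_l ((p (rshift m l) \notin F2) && (m <= P (p (rshift m l)))))%N.
  rewrite -big_split /=; apply: eq_bigr => l _; rewrite /g.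
  by case: (_ \in F2) => //=; rewrite addn0.
by move=> E1 E2; move/eqP: (etrans E2 (esym E1)); rewrite addnCA addnC eqn_add2l => /eqP->; rewrite addnC.
Qed.

(** If [T a i] is high, so are all exchanged entries of [T a]; its low entries thus lie in [F1] and
    stay on the left. *)
Lemma low_left : (m <= T a i)%N ->
  (\sum_l ((p (lshift m l) \notin F1) && (P (p (lshift m l)) < m)) + nbLow (T a) = lowl)%N.
Proof.
move=> Tai; pose g (k : 'I_(m + m)) : nat := (k \in F1) && (P k < m)%N.
have gl : (\sum_l g (p (lshift m l)) = nbLow (T a))%N.
  have := sum_lr g; rewrite [X in (_ + X)%N]big1 ?addn0 => [->|l _]; last by rewrite /g (negPf (pF1 l)).
  rewrite [X in (_ + X)%N]big1 ?addn0 => [|l _].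
    apply: eq_bigr => l _; rewrite /g inE /= Pl.
    by case: ltnP => //= leil; rewrite ltnNge (leq_trans Tai (incr a leil)).
  by rewrite /g inE /= ltnNge (leq_trans (ltnW (ltn_ord i)) (leq_addr _ _)).
rewrite -gl -big_split /=; apply: eq_bigr => l _; rewrite /g.
by case: (_ \in F1) => //=; rewrite addn0.
Qed.
End Perm.

Let GYX : X *m row_mx 1%:M Y = row_mx X t%:M.
Proof. by rewrite mul_mx_row mulmx1 XY. Qed.
Let GXY : Y *m row_mx X 1%:M = row_mx t%:M Y.
Proof. by rewrite mul_mx_row mulmx1 YX. Qed.

Let rest := \prod_(c | (c != a) && (c != b)) tabMinor c (T c).

Let newTab_value p : tabValue (newTab p) = t ^+ (r - xDegree (newTab p)) *
  (tabMinor a (fun l => P (p (lshift m l))) * tabMinor b (fun l => P (p (rshift m l)))) * rest.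
Proof.
rewrite /tabValue (bigD1 a) // (bigD1 b) ?neqab //= -!mulrA; congr (_ * _).
have HM c (f g : 'I_m -> 'I_(m + m)) : f =1 g -> tabMinor c f = tabMinor c g.
  by move=> fg; congr (\det _); apply/matrixP=> k l; rewrite !mxE fg.
congr (_ * (_ * _)).
- by apply: HM => l; rewrite ffunE eqxx ffunE.
- by apply: HM => l; rewrite ffunE neqab eqxx ffunE.
- by apply: eq_bigr => c /andP[/negPf ca /negPf cb]; rewrite ffunE ca cb.
Qed.

Let newTab1 : newTab 1 = T.
Proof.
apply/ffunP=> c; rewrite ffunE.
case: eqP => [->|_]; first by apply/ffunP=> l; rewrite ffunE perm1 Pl.
by case: eqP => [->|//]; apply/ffunP=> l; rewrite ffunE perm1 Pr.
Qed.

(** The exchange at the violation expresses the value by values of lighter tableaux. [V] is any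
    additive subgroup containing those, later the span of the standard values. *)
Lemma exchange_step (V : R -> Prop) :
  V 0 -> (forall x y, V x -> V y -> V (x - y)) ->
  (forall U, (xDegree U <= r)%N -> (\sum_c nbLow (U c) = \sum_c nbLow (T c))%N ->
     (tabWeight U < tabWeight T)%N -> V (tabValue U)) ->
  V (tabValue T).
Proof.
move=> V0 VB IH.
(* It remains to find matrices for [det_exchange] whose minors are the two factors up to powers of
   [t], these powers making up for the change of [xDegree]. *)
suff [N1 [N2 [L HL HN]]] : exists N1 N2 : 'M[R]_(m, m + m), exists2 L : 'M[R]_m,
   (forall j, j \notin F1 -> j \notin F2 -> col j N2 = L *m col j N1) \/
   (forall j, j \notin F1 -> j \notin F2 -> col j N1 = L *m col j N2) &
   forall p : 'S_(m + m), (forall j, p (rshift m j) \notin F1) ->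
     (forall j, p (lshift m j) \notin F2) -> (xDegree (newTab p) <= r)%N /\
     t ^+ (r - xDegree T) * (\det (colsub (fun j => p (lshift m j)) N1) *
             \det (colsub (fun j => p (rshift m j)) N2)) =
     t ^+ (r - xDegree (newTab p)) * (tabMinor a (fun l => P (p (lshift m l))) *
        tabMinor b (fun l => P (p (rshift m l)))).
  have -> : tabValue T = t ^+ (r - xDegree T) * rest * (\det (lsubmx N1) * \det (rsubmx N2)).
    rewrite -{1}newTab1 newTab_value [RHS]mulrAC; congr (_ * _).
    have le_shift (k l : 'I_m) : (k <= m + l)%N.
      by rewrite (leq_trans (ltnW (ltn_ord k))) ?leq_addr.
    have [l|l|_ <-] := HN 1%g; first by rewrite perm1 inE /= ltnNge le_shift.
      by rewrite perm1 inE /= ltnNge le_shift.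
    congr (_ * _); congr (_ * _); congr (\det _); apply/matrixP=> k l; rewrite !mxE perm1 //.
  apply: (det_exchange V0 VB _ _ _ HL) => [j|j||p [j _ lemj] pF1 pF2].
  - by rewrite inE => /leq_trans; apply; apply: ltnW.
  - by rewrite inE => /ltnW; apply: leq_trans; apply: leq_addr.
  - pose A1 := [set l : 'I_m | (l < i)%N]; pose A2 := [set l : 'I_m | (i < l)%N].
    have -> : F1 = [set lshift m l | l in A1].
      apply/setP=> k; apply/idP/imsetP => [|[l + ->]]; last by rewrite !inE.
      rewrite inE => ltki; have ltkm := ltn_trans ltki (ltn_ord i).
      by exists (Ordinal ltkm); rewrite ?inE //; apply: val_inj.
    have -> : F2 = [set rshift m l | l in A2].
      apply/setP=> k; apply/idP/imsetP => [|[l + ->]]; last by rewrite !inE /= ltn_add2l.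
      rewrite inE; case: (split_ordP k) => l -> /=.
        by rewrite ltnNge (leq_trans (ltnW (ltn_ord l)) (leq_addr _ _)).
      by rewrite ltn_add2l => ltil; exists l; rewrite ?inE.
    rewrite (card_imset _ (@lshift_inj _ _)) (card_imset _ (@rshift_inj _ _)).
    rewrite -cardsUI (_ : A1 :&: A2 = set0) ?cards0 ?addn0; last first.
      by apply/setP=> l; rewrite !inE; case: ltngtP.
    rewrite -[ltnRHS]card_ord -cardsT; apply: proper_card; apply/properP.
    by split; [apply: subsetT|exists i; rewrite !inE // ltnn].
  have [xp Ep] := HN p pF1 pF2.
  rewrite mulrAC Ep -newTab_value; apply: IH => //; first exact: newTab_total.
  exact: newTab_weight lemj.
have same : graphMx a = graphMx b /\ (s <= a)%N = (s <= b)%N \/ (a < s)%N /\ (s <= b)%N.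
  rewrite /graphMx; case: (ltnP a s) => sa; case: (ltnP b s) => sb; try by [left|right].
  by move: (leq_trans sa (ltnW ltab)); rewrite leqNgt sb.
(* Two factors from the same matrix: this is the ordinary Pluecker relation, with [L = 1] and
   unchanged [xDegree]. *)
have [[Eab sab]|[sa sb]] := same.
  exists (colsub P (graphMx a)), (colsub P (graphMx a)), 1%:M.
    by left=> j _ _; rewrite mul1mx.
  move=> p pF1 pF2; have Ex : xDegree (newTab p) = xDegree T.
    have := newTab_xDegree p; have := low_lr p.
    move: (bigop _ _ _) (bigop _ _ _) (nbLow _) (nbLow _) => u v w z.
    by rewrite sab; case: (s <= b)%N; lia.
  rewrite Ex; split=> //; congr (_ * _); congr (_ * _); rewrite /tabMinor -?Eab;
    by congr (\det _); apply/matrixP=> k l; rewrite !mxE.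
(* As [X [1 | Y] = [X | t]] and [Y [X | 1] = [t | Y]], the exchanged columns of the two
   matrices are related by [X], or by [Y], up to powers of [t]; the relation is chosen so
   that the original term gets no power of [t]. *)
have Ga : graphMx a = row_mx 1%:M Y by rewrite /graphMx sa.
have Gb : graphMx b = row_mx X 1%:M by rewrite /graphMx ltnNge sb.
(* If [T b i] is low, each high moved entry landing on the right contributes a [t]; by [low_right]
   the number of these entries is the drop of [xDegree]. *)
have [Tbi|Tbi] := ltnP (T b i) m.
  exists (colsub P (graphMx a)).
  exists (\matrix_(k, l) (graphMx b k (P l) * t ^+ ((l \notin F2) && (m <= P l)%N))).
  exists X => [|p pF1 pF2].
    left=> j _ jF2; apply/colP=> k.
    have -> : X *m col j (colsub P (graphMx a)) = col (P j) (row_mx X t%:M).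
      by rewrite -GYX -Ga; apply/colP=> l; rewrite !mxE; apply: eq_bigr => l' _; rewrite !mxE.
    rewrite !mxE jF2 Gb !mxE; case: splitP => l El.
      by rewrite leqNgt El ltn_ord expr0 mulr1.
    by rewrite El leq_addr expr1 !mxE mulr_natl.
  have := newTab_xDegree p; have := low_lr p; have := low_right pF2 Tbi.
  rewrite sb leqNgt sa mul0n mul1n add0n !mul0n !add0n mul1n.
  have -> : \det (colsub (fun j => p (lshift m j)) (colsub P (graphMx a))) =
      tabMinor a (fun l => P (p (lshift m l))).
    by congr (\det _); apply/matrixP=> k l; rewrite !mxE.
  set N := \matrix_(k, l) _.
  have -> : \det (colsub (fun j => p (rshift m j)) N) =
      tabMinor b (fun l => P (p (rshift m l))) *
      t ^+ (\sum_l ((p (rshift m l) \notin F2) && (m <= P (p (rshift m l)))))%N.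
    by rewrite -(det_scale _ t); congr (\det _); apply/matrixP=> k l; rewrite !mxE.
  move: (nbLow (T a)) (nbLow (T b)) => u v; move: (bigop _ _ _) => e.
  move: (\sum_(l < m) (P (p (rshift m l)) < m)%N)%N => w E1 _ E3.
  have -> : (r - xDegree (newTab p) = r - xDegree T + e)%N by lia.
  by split; [lia|rewrite exprD -!mulrA; congr (_ * _); rewrite [RHS]mulrC !mulrA].
(* Now [T b i], hence also [T a i], is high. The powers of [t] come from the low moved entries
   landing on the left; by [low_left] their number is the drop of [xDegree]. *)
exists (\matrix_(k < m, l < m + m) (graphMx a k (P l) * t ^+ ((l \notin F1) && (P l < m)%N))).
exists (colsub P (graphMx b)).
exists Y => [|p pF1 pF2].
  right=> j jF1 _; apply/colP=> k.
  have -> : Y *m col j (colsub P (graphMx b)) = col (P j) (row_mx t%:M Y).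
    by rewrite -GXY -Gb; apply/colP=> l; rewrite !mxE; apply: eq_bigr => l' _; rewrite !mxE.
  rewrite !mxE jF1 Ga !mxE; case: splitP => l El.
    by rewrite expr1 !mxE mulr_natl.
  by rewrite expr0 mulr1.
have Tai : (m <= T a i)%N by rewrite (leq_trans Tbi) // ltnW.
have := newTab_xDegree p; have := low_lr p; have := low_left pF1 Tai.
rewrite sb leqNgt sa mul0n mul1n add0n !mul0n !add0n mul1n.
have -> : \det (colsub (fun j => p (rshift m j)) (colsub P (graphMx b))) =
    tabMinor b (fun l => P (p (rshift m l))).
  by congr (\det _); apply/matrixP=> k l; rewrite !mxE.
set N := \matrix_(k, l) _.
have -> : \det (colsub (fun j => p (lshift m j)) N) =
    tabMinor a (fun l => P (p (lshift m l))) *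
    t ^+ (\sum_l ((p (lshift m l) \notin F1) && (P (p (lshift m l)) < m)))%N.
  by rewrite -(det_scale _ t); congr (\det _); apply/matrixP=> k l; rewrite !mxE.
move: (nbLow (T a)) (nbLow (T b)) => u v; move: (bigop _ _ _) => e.
move: (\sum_(l < m) (P (p (lshift m l)) < m)%N)%N => w'.
move: (\sum_(l < m) (P (p (rshift m l)) < m)%N)%N => w E1 E2 E3.
have -> : (r - xDegree (newTab p) = r - xDegree T + e)%N by lia.
by split; [lia|rewrite exprD -!mulrA; congr (_ * _); rewrite mulrCA].
Qed.
End Step.

(** Induction on [tabWeight]. Each column is first sorted, at the cost of a sign, unless a repeated
    entry makes the minor vanish; an increasing tableau is standard or has a violation to exchange.
    The number [n] of low entries is preserved, as it fixes the degree in [Y]. *)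
Lemma tab_straightening (n : nat) (V : R -> Prop) :
  V 0 -> (forall x y, V x -> V y -> V (x - y)) ->
  (forall S, tabStandard S -> (xDegree S <= r)%N -> (\sum_c nbLow (S c) = n)%N ->
     V (tabValue S)) ->
  forall T, (xDegree T <= r)%N -> (\sum_c nbLow (T c) = n)%N -> V (tabValue T).
Proof.
move=> V0 VB Vstd T; have [w] := ubnP (tabWeight T).
elim: w T => // w IHw T ltTw T_adm T_tot.
have [/forallP T_inj|] := boolP [forall c, injectiveb (T c)]; last first.
  case/forallPn=> c /injectivePn[i [j neqij Tij]].
  by rewrite /tabValue (bigD1 c) //= (tabMinor_repeat c neqij Tij) mul0r mulr0.
have /fin_all_exists[p Hp] c : exists p : 'S_m, forall i j : 'I_m, (i < j)%N ->
    (T c (p i) < T c (p j))%N by apply/sort_column/injectiveP/T_inj.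
pose U : tableau := [ffun c => [ffun i => T c (p c i)]].
have Uc c (f : 'I_(m + m) -> nat) : (\sum_i f (U c i) = \sum_i f (T c i))%N.
  rewrite [RHS](reindex_inj (@perm_inj _ (p c))).
  by apply: eq_bigr => i _; rewrite !ffunE.
have Ulow c : nbLow (U c) = nbLow (T c) by apply: (Uc c (fun k => (k < m)%N)).
have Ux : xDegree U = xDegree T by apply: eq_bigr => c _; rewrite Ulow.
have Uw : tabWeight U = tabWeight T.
  by apply: eq_bigr => c _; rewrite (Uc c (fun k => k)).
have Ut : (\sum_c nbLow (U c) = \sum_c nbLow (T c))%N by apply: eq_bigr => c _; rewrite Ulow.
suff VU : V (tabValue U).
  have -> : tabValue T = (\prod_c (-1) ^+ p c) * tabValue U.
    rewrite /tabValue Ux mulrCA; congr (_ * _); rewrite -big_split /=.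
    apply: eq_bigr => c _; have -> : tabMinor c (U c) = (-1) ^+ p c * tabMinor c (T c).
      rewrite -tabMinor_perm; congr (\det _).
      by apply/matrixP=> k l; rewrite !mxE !ffunE.
    by rewrite mulrA -expr2 sqrr_sign mul1r.
  have [->|->] : \prod_c (-1) ^+ p c = 1 :> R \/ \prod_c (-1) ^+ p c = -1 :> R.
  - apply: (big_ind (fun x : R => x = 1 \/ x = -1)) => [|x y [->|->] [->|->]|c _]; first by left.
    + by left; rewrite mulr1.
    + by right; rewrite mul1r.
    + by right; rewrite mulr1.
    + by left; rewrite mulrNN mulr1.
    + by case: odd_perm; [right|left].
  - by rewrite mul1r.
  - by rewrite mulN1r -sub0r; apply: VB.
have U_incr : tabIncr U.
  apply/forallP=> c; apply/forallP=> i; apply/forallP=> j; apply/implyP=> ltij.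
  by rewrite !ffunE Hp.
have [U_std|] := boolP (tabStandard U); first by apply: Vstd; rewrite ?Ux ?Ut.
rewrite /tabStandard U_incr /= => /forallPn[a /forallPn[b /forallPn[i]]].
rewrite negb_imply -ltnNge => /andP[ltab viol].
apply: (exchange_step U_incr ltab viol) => // [|S S_adm S_tot ltS]; first by rewrite Ux.
apply: IHw => //; last by rewrite S_tot Ut.
by rewrite -ltnS (leq_trans _ ltTw) // ltnS -Uw.
Qed.
End Straightening.

(** * Minors of [[A | B]] and the substitution [X = adj(B) A], [Y = adj(A) B] *)

Section GenericMinors.
Variables (D : idomainType) (m r s : nat) (A B : 'M[D]_m).
Hypotheses (m_gt0 : (0 < m)%N) (detA : \det A != 0) (detB : \det B != 0).

Lemma det_adj_idomain (M : 'M[D]_m) : \det M != 0 -> \det (\adj M) = \det M ^+ m.-1.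
Proof.
move=> M0; apply: (mulfI M0); rewrite -det_mulmx mul_mx_adj det_scalar -exprS.
by rewrite prednK.
Qed.

Let X := \adj B *m A.
Let Y := \adj A *m B.
Let t := \det A * \det B.

Lemma adj_graph_mul : X *m Y = t%:M /\ Y *m X = t%:M.
Proof.
rewrite /X /Y; split.
  rewrite mulmxA -(mulmxA _ A) mul_mx_adj -(mulmxA (\adj B)) mul_scalar_mx -scalemxAr.
  by rewrite mul_adj_mx scale_scalar_mx.
rewrite mulmxA -(mulmxA _ B) mul_mx_adj -(mulmxA (\adj A)) mul_scalar_mx -scalemxAr.
by rewrite mul_adj_mx scale_scalar_mx mulrC.
Qed.

(** Multiplying [[A | B]] by [adj(B)] gives [[X | det B]], so each high column carries a factor
    [det B]; the determinant of [adj(B)] gives the power on the right. *)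
Lemma minor_X (al : {ffun 'I_m -> 'I_(m + m)}) :
  \det B ^+ (m - nbLow al) * \det (colsub al (row_mx X 1%:M)) =
  \det B ^+ m.-1 * \det (colsub al (row_mx A B)).
Proof.
have -> : (m - nbLow al = \sum_l (m <= al l))%N.
  rewrite /nbLow -[X in (X - _)%N]card_ord -sum1_card.
  rewrite -sumnB => [|l _]; last by case: ltnP.
  by apply: eq_bigr => l _; case: ltnP.
rewrite mulrC -det_scale -det_adj_idomain // -det_mulmx; congr (\det _).
rewrite mulmx_colsub mul_mx_row mul_adj_mx; apply/matrixP=> k l; rewrite !mxE.
case: splitP => j El; first by rewrite leqNgt El ltn_ord expr0 mulr1.
by rewrite El leq_addr expr1 !mxE mulr_natl.
Qed.

Lemma minor_Y (al : {ffun 'I_m -> 'I_(m + m)}) :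
  \det A ^+ nbLow al * \det (colsub al (row_mx 1%:M Y)) =
  \det A ^+ m.-1 * \det (colsub al (row_mx A B)).
Proof.
rewrite mulrC -det_scale -det_adj_idomain // -det_mulmx; congr (\det _).
rewrite mulmx_colsub mul_mx_row mul_adj_mx; apply/matrixP=> k l; rewrite !mxE.
case: splitP => j El; last by rewrite expr0 mulr1.
by rewrite expr1 !mxE mulr_natl.
Qed.

(** The number of low entries is such that, after the powers coming from the adjugates are
    cancelled, [det A] and [det B] both keep the exponent [r - xDegree T], which is that of [t]. *)
Lemma tabValue_graph (T : {ffun 'I_(s + r) -> {ffun 'I_m -> 'I_(m + m)}}) :
  (xDegree T <= r)%N -> (\sum_c nbLow (T c) = r + m.-1 * s)%N ->
  tabValue X Y t T = \prod_c \det (colsub (T c) (row_mx A B)).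
Proof.
move=> T_adm; have xE : xDegree T = (\sum_(c < r) nbLow (T (rshift s c)))%N.
  rewrite /xDegree big_split_ord /= big_pred0 ?add0n => [|c].
    by apply: eq_bigl => c; rewrite leq_addr.
  by rewrite leqNgt ltn_ord.
rewrite big_split_ord /= -xE => T_tot.
have lowm c : (nbLow (T c) <= m)%N.
  by rewrite -[leqRHS]card_ord -sum1_card leq_sum // => l _; case: (_ < _)%N.
rewrite /tabValue !big_split_ord /=.
have Ep : \det B ^+ (m * r - xDegree T) * \prod_(c < r) tabMinor X Y (rshift s c) (T (rshift s c)) =
    \det B ^+ (m.-1 * r) * \prod_(c < r) \det (colsub (T (rshift s c)) (row_mx A B)).
  have -> : (m * r - xDegree T = \sum_(c < r) (m - nbLow (T (rshift s c))))%N.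
    by rewrite sumnB // sum_nat_const card_ord mulnC xE.
  have -> : (m.-1 * r = \sum_(c < r) m.-1)%N by rewrite sum_nat_const card_ord mulnC.
  rewrite -!prodrXr -!big_split; apply: eq_bigr => c _ /=.
  by rewrite /tabMinor /graphMx /= ltnNge leq_addr minor_X.
have Eq : \det A ^+ (\sum_(c < s) nbLow (T (lshift r c))) *
      \prod_(c < s) tabMinor X Y (lshift r c) (T (lshift r c)) =
    \det A ^+ (m.-1 * s) * \prod_(c < s) \det (colsub (T (lshift r c)) (row_mx A B)).
  have -> : (m.-1 * s = \sum_(c < s) m.-1)%N by rewrite sum_nat_const card_ord mulnC.
  rewrite -!prodrXr -!big_split; apply: eq_bigr => c _ /=.
  by rewrite /tabMinor /graphMx /= ltn_ord minor_Y.
have E1 : (m * r - xDegree T = m.-1 * r + (r - xDegree T))%N.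
  by move: m_gt0 (xDegree T) T_adm => + x; case: (m) => //= m' _; rewrite mulSn; lia.
have E2 : (\sum_(c < s) nbLow (T (lshift r c)) = m.-1 * s + (r - xDegree T))%N.
  by apply: (@addIn (xDegree T)); rewrite T_tot -addnA subnK // addnC.
rewrite E1 exprD -mulrA in Ep; rewrite E2 exprD -mulrA in Eq.
have {}Ep := mulfI (expf_neq0 _ detB) Ep; have {}Eq := mulfI (expf_neq0 _ detA) Eq.
by rewrite -Eq -Ep /t exprMn !mulrA; congr (_ * _); rewrite mulrAC.
Qed.
End GenericMinors.

(** * Linear independence of the standard products *)

Lemma eq_digits (b N : nat) (e e' : nat -> nat) :
  (forall k, e k < b)%N -> (forall k, e' k < b)%N ->
  (\sum_(k < N) e k * b ^ k = \sum_(k < N) e' k * b ^ k)%N ->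
  forall k, (k < N)%N -> e k = e' k.
Proof.
elim: N e e' => // N IHN e e' lt_e lt_e'.
have shift (f : nat -> nat) : (\sum_(k < N.+1) f k * b ^ k = (\sum_(k < N) f k.+1 * b ^ k) * b + f 0%N)%N.
  rewrite big_ord_recl expn0 muln1 addnC big_distrl; congr (_ + _)%N.
  by apply: eq_bigr => k _; rewrite expnSr mulnA.
have b_gt0 : (0 < b)%N by apply: leq_ltn_trans (lt_e 0%N).
rewrite !shift => E; have E0 : e 0%N = e' 0%N.
  by have := congr1 (modn^~ b) E; rewrite !modnMDl !modn_small.
move/eqP: E; rewrite E0 eqn_add2r eqn_pmul2r // => /eqP E [|k] //.
by rewrite ltnS; apply: (IHN (fun k => e k.+1) (fun k => e' k.+1)).
Qed.

Lemma nondecr_eq_count (d n : nat) (f g : 'I_d -> 'I_n) :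
  {homo f : x y / (x < y)%N >-> (x <= y)%N} -> {homo g : x y / (x < y)%N >-> (x <= y)%N} ->
  (forall j, \sum_a (f a == j) = \sum_a (g a == j))%N -> f =1 g.
Proof.
move=> f_mon g_mon fg.
pose u (h : 'I_d -> 'I_n) := [tuple h a | a < d].
have u_count h j : count_mem j (u h) = (\sum_a (h a == j))%N.
  rewrite /= count_map -sum1_count big_enum_cond /= big_mkcond /=.
  by apply: eq_bigr => a _; case: eqP.
have u_sorted (h : 'I_d -> 'I_n) : {homo h : x y / (x < y)%N >-> (x <= y)%N} ->
    sorted (fun x y : 'I_n => x <= y)%N (u h).
  move=> h_mon; rewrite /=.
  apply: (homo_sorted (e := fun x y : 'I_d => (x < y)%N)) => [x y|]; first exact: h_mon.
  by have := iota_ltn_sorted 0 d; rewrite -val_enum_ord sorted_map.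
have E : u f = u g.
  apply: val_inj; apply: (sorted_eq (leT := fun x y : 'I_n => (x <= y)%N)).
  - by move=> x y z; apply: leq_trans.
  - by move=> x y; rewrite -eqn_leq => /eqP/val_inj.
  - exact: u_sorted.
  - exact: u_sorted.
  - by apply/allP=> j _ /=; rewrite !u_count fg.
by move=> a; have := congr1 (fun t => tnth t a) E; rewrite !tnth_mktuple.
Qed.

Section Independence.
Variables (K : fieldType) (m r s : nat).

Local Notation tableau := {ffun 'I_(s + r) -> {ffun 'I_m -> 'I_(m + m)}}.
(** The base exceeds the number of cells, so that multiplicities of cells are digits in base [b],
    and it exceeds [m], so that [m] powers of smaller exponent cannot add up to the next power. *)
Let b := ((s + r) * m + m).+1.
(** Both indices are reversed to give the largest ranks to the top row and, within a row, to the
    smallest column indices. *)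
Definition cellRank (i : 'I_m) (j : 'I_(m + m)) : nat := (rev_ord i * (m + m) + rev_ord j)%N.

Lemma cellRank_row (i i' : 'I_m) j j' : (i < i')%N -> (cellRank i' j' < cellRank i j)%N.
Proof.
move=> ltii'; rewrite /cellRank.
have lt1 : (rev_ord i' < rev_ord i)%N by rewrite /=; have := ltn_ord i'; lia.
apply: (@leq_trans (rev_ord i' * (m + m) + (m + m))); first by rewrite ltn_add2l.
by rewrite addnC -mulSn (leq_trans _ (leq_addr _ _)) // leq_mul2r lt1 orbT.
Qed.

Lemma cellRank_col i (j j' : 'I_(m + m)) : (j < j')%N -> (cellRank i j' < cellRank i j)%N.
Proof. by move=> ltjj'; rewrite ltn_add2l /=; have := ltn_ord j'; lia. Qed.

Lemma cellRank_inj i j i' j' : cellRank i j = cellRank i' j' -> i = i' /\ j = j'.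
Proof.
have [lt|lt|/val_inj<-] := ltngtP i i'.
- by move=> E; have := cellRank_row j j' lt; rewrite E ltnn.
- by move=> E; have := cellRank_row j' j lt; rewrite E ltnn.
have [lt|lt|/val_inj<-] // := ltngtP j j'.
- by move=> E; have := cellRank_col i lt; rewrite E ltnn.
- by move=> E; have := cellRank_col i lt; rewrite E ltnn.
Qed.

Lemma cellRank_lt i j : (cellRank i j < m * (m + m))%N.
Proof.
apply: (@leq_trans (rev_ord i * (m + m) + (m + m))); first by rewrite ltn_add2l.
by rewrite addnC -mulSn leq_mul2r orbC; apply/orP; left; apply: (ltn_ord (rev_ord i)).
Qed.

(* The exponents are such that the diagonal term of each minor dominates, and the
   degree of a product of minors records all the entries of the tableau. *)
Definition powerMx : 'M[{poly K}]_(m, m + m) := \matrix_(i, j) 'X^(b ^ cellRank i j).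

Definition columnDegree (al : 'I_m -> 'I_(m + m)) : nat := (\sum_i b ^ cellRank i (al i))%N.

(** At the first row moved by [p] the image is larger, so the rank is smaller there; later rows rank
    below the diagonal cell of this row anyway. The at most [m] remaining powers of [b] add up to
    less than the power of that cell. *)
Lemma columnDegree_perm (al : 'I_m -> 'I_(m + m)) (p : 'S_m) :
  (forall i j : 'I_m, (i < j)%N -> (al i < al j)%N) -> p != 1%g ->
  (columnDegree (fun i => al (p i)) < columnDegree al)%N.
Proof.
move=> al_incr; move/eqP => p1.
have [i0 pi0] : exists i, p i != i.
  apply/existsP; apply: contra_notT p1 => /existsPn p1; apply/permP=> i.
  by rewrite perm1; apply/eqP; move: (p1 i); rewrite negbK.
case: (@arg_minnP _ i0 (fun i => p i != i) val pi0) => i {i0} {}pi0 i_min.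
have fix_lt (k : 'I_m) : (k < i)%N -> p k = k.
  by move=> ltki; apply/eqP; apply: contraLR ltki => /i_min; rewrite -leqNgt.
have ltip : (i < p i)%N.
  rewrite ltn_neqAle eq_sym (inj_eq val_inj) pi0 /= leqNgt.
  by apply/negP=> lt; case/eqP: (pi0); apply: (@perm_inj _ p); apply: fix_lt.
rewrite /columnDegree (bigID (fun k : 'I_m => (k < i)%N)) /=.
rewrite [X in (_ < X)%N](bigID (fun k : 'I_m => (k < i)%N)) /=.
rewrite (eq_bigr (fun k : 'I_m => (b ^ cellRank k (al k))%N)) => [|k /fix_lt->//].
rewrite ltn_add2l [X in (_ < X)%N](bigD1 i) ?ltnn //=.
set E := cellRank i (al i); apply: (leq_trans _ (leq_addr _ _)).
have lt_rank (k : 'I_m) : ~~ (k < i)%N -> (cellRank k (al (p k)) < E)%N.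
  rewrite -leqNgt leq_eqVlt => /predU1P[/val_inj<-|]; last exact: cellRank_row.
  by apply/cellRank_col/al_incr.
have E_gt0 : (0 < E)%N by apply: leq_ltn_trans (lt_rank i _); rewrite ?ltnn.
apply: (@leq_ltn_trans (m * b ^ E.-1)%N).
  rewrite -[X in (X * _)%N]card_ord -sum_nat_const big_mkcond leq_sum // => k _.
  case: ifP => // /lt_rank ltE; rewrite leq_pexp2l // -ltnS prednK //.
by rewrite -[X in (_ < b ^ X)%N](prednK E_gt0) expnS ltn_pmul2r ?expn_gt0 // /b ltnS leq_addl.
Qed.

Lemma size_minor_powerMx (al : 'I_m -> 'I_(m + m)) :
  (forall i j : 'I_m, (i < j)%N -> (al i < al j)%N) ->
  size (\det (colsub al powerMx)) = (columnDegree al).+1.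
Proof.
move=> al_incr; rewrite /determinant (bigD1 1%g) //= odd_perm1 expr0 mul1r.
have termE (p : 'S_m) : \prod_i colsub al powerMx i (p i) = 'X^(columnDegree (fun i => al (p i))).
  by rewrite /columnDegree -prodrXr; apply: eq_bigr => i _; rewrite !mxE.
rewrite termE (_ : columnDegree _ = columnDegree al); last first.
  by apply: eq_bigr => i _; rewrite perm1.
rewrite size_polyDl size_polyXn // ltnS.
apply: (big_ind (fun q : {poly K} => size q <= columnDegree al)%N) => [|q q' sq sq'|p p1].
- by rewrite size_poly0.
- by rewrite (leq_trans (size_polyD _ _)) // geq_max sq sq'.
by rewrite termE mulr_sign; case: ifP => _; rewrite ?size_polyN size_polyXn columnDegree_perm.
Qed.

Definition tabDegree (T : tableau) : nat := (\sum_a columnDegree (T a))%N.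

Lemma size_tab_powerMx (T : tableau) : tabIncr T ->
  size (\prod_a \det (colsub (T a) powerMx)) = (tabDegree T).+1.
Proof.
move=> T_incr; have sz a : size (\det (colsub (T a) powerMx)) = (columnDegree (T a)).+1.
  apply: size_minor_powerMx => i j.
  by move/forallP/(_ a)/forallP/(_ i)/forallP/(_ j)/implyP: T_incr.
rewrite size_prod => [|a _]; last by rewrite -size_poly_gt0 sz.
under eq_bigr do rewrite sz -addn1.
by rewrite big_split /= sum1_card -addSn addnK.
Qed.

(** The digits of the degree in base [b] count how often each column index occurs in each row, and
    the rows of a standard tableau are sorted. *)
Lemma tabDegree_inj (S T : tableau) :
  tabStandard S -> tabStandard T -> tabDegree S = tabDegree T -> S = T.
Proof.
move=> /andP[_ S_std] /andP[_ T_std] degE.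
pose e (U : tableau) k := (\sum_a \sum_i (cellRank i (U a i) == k))%N.
have lt_e U k : (e U k < b)%N.
  rewrite /b ltnS (leq_trans _ (leq_addr _ _)) //.
  rewrite -[X in (_ <= X * _)%N]card_ord -sum_nat_const leq_sum // => a _.
  rewrite -[X in (_ <= X)%N]card_ord -sum1_card leq_sum // => i _.
  by case: eqP.
have degU U : tabDegree U = (\sum_(k < m * (m + m)) e U k * b ^ k)%N.
  rewrite /e; under [RHS]eq_bigr do rewrite big_distrl /=.
  rewrite [RHS]exchange_big /=; apply: eq_bigr => a _.
  under [RHS]eq_bigr do rewrite big_distrl /=.
  rewrite [RHS]exchange_big /=; apply: eq_bigr => i _.
  rewrite (bigD1 (Ordinal (cellRank_lt i (U a i)))) //= eqxx mul1n big1 ?addn0 // => k neqk.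
  case: eqP => [E|]; last by rewrite mul0n.
  by case/eqP: neqk; apply: val_inj.
rewrite !degU in degE; have {}degE := eq_digits (lt_e S) (lt_e T) degE.
have e_cell U i j : e U (cellRank i j) = (\sum_a (U a i == j))%N.
  apply: eq_bigr => a _; rewrite (bigD1 i) //= big1 => [|i' neqi].
    rewrite addn0; congr (nat_of_bool _).
    by apply/eqP/eqP=> [/cellRank_inj[]|->].
  by case: eqP => // /cellRank_inj[E]; case/eqP: neqi.
apply/ffunP=> a; apply/ffunP=> i.
apply: (nondecr_eq_count (f := fun a => S a i) (g := fun a => T a i)) => [x y|x y|j].
- by move: S_std => /forallP/(_ x)/forallP/(_ y)/forallP/(_ i)/implyP.
- by move: T_std => /forallP/(_ x)/forallP/(_ y)/forallP/(_ i)/implyP.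
- by rewrite -!e_cell degE ?cellRank_lt.
Qed.

(** Distinct standard products have distinct degrees, so the one of largest degree among those with
    nonzero coefficient cannot cancel. *)
Lemma standard_minors_free (c : tableau -> K) :
  \sum_(S | tabStandard S) (c S)%:P * \prod_a \det (colsub (S a) powerMx) = 0 ->
  forall S, tabStandard S -> c S = 0.
Proof.
move=> c0 S0 S0_std; apply/eqP; apply: contraTT isT => cS0.
have : tabStandard S0 && (c S0 != 0) by rewrite S0_std.
case/(@arg_maxnP _ S0 (fun S => tabStandard S && (c S != 0)) tabDegree) => S /andP[S_std cS] S_max.
move/(congr1 (fun q : {poly K} => q`_(tabDegree S)))/eqP: c0.
rewrite coef0 coef_sum (bigD1 S) //= [X in _ + X]big1; last first.
  move=> T /andP[T_std neqT].
  rewrite coefCM; have [->|cT] := eqVneq (c T) 0; first by rewrite mul0r.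
  rewrite nth_default ?mulr0 // size_tab_powerMx; last by case/andP: T_std.
  have {}S_max : (tabDegree T <= tabDegree S)%N by apply: S_max; rewrite T_std cT.
  move: S_max; rewrite leq_eqVlt => /predU1P[|//].
  by move=> E; case/eqP: neqT; apply: tabDegree_inj.
rewrite addr0  coefCM mulf_eq0 (negPf cS) /=.
  rewrite -[tabDegree S]/((tabDegree S).+1.-1) -size_tab_powerMx; last by case/andP: S_std.
  rewrite -/(lead_coef _) lead_coef_eq0 -size_poly_eq0 size_tab_powerMx //.
  by case/andP: S_std.
Qed.
End Independence.

(** * The functional attached to a commuting endomorphism *)

Section MixedMonomials.
Variables (K : fieldType) (m r s : nat).
Local Notation index := {ffun 'I_(r + s) -> 'I_m}.
Local Notation letter := (bool * ('I_m * 'I_m))%type.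
Local Notation nvars := #|{: letter}|.
Local Notation poly := {mpoly K[nvars]}.
Implicit Types I J : index.

Definition mixedVar (v : letter) : 'I_nvars := enum_rank v.
Definition varMxX : 'M[poly]_m := \matrix_(i, j) 'X_(mixedVar (true, (i, j))).
Definition varMxY : 'M[poly]_m := \matrix_(i, j) 'X_(mixedVar (false, (i, j))).

(** [true] marks the entries of [X], [false] those of [Y]. The indices are swapped on the factors
    [W], where the group acts by the transposed inverse. *)
Definition mixedLetter I J (k : 'I_(r + s)) : letter :=
  if (k < r)%N then (true, (I k, J k)) else (false, (J k, I k)).
Definition mixedMnm I J : 'X_{1..nvars} :=
  (\sum_k U_(mixedVar (mixedLetter I J k)))%MM.

(** A commutative monomial forgets only the order of its letters, and each letter tells on which
    side of the wall it stands. *)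
Lemma mixedMnmP I J I' J' : mixedMnm I J = mixedMnm I' J' ->
  exists2 p : 'S_(r + s), (forall k, (p k < r)%N = (k < r)%N) &
    forall k, I' k = I (p k) /\ J' k = J (p k).
Proof.
move=> E; pose v := [tuple mixedLetter I J k | k < r + s].
pose v' := [tuple mixedLetter I' J' k | k < r + s].
have cE H1 H2 a : (mixedMnm H1 H2 (mixedVar a) =
    count_mem a [tuple mixedLetter H1 H2 k | k < r + s])%N.
  rewrite /mixedMnm mnm_sumE /= count_map -sum1_count big_enum_cond /= [RHS]big_mkcond /=.
  apply: eq_bigr => k _; rewrite mnm1E /mixedVar (inj_eq enum_rank_inj).
  by case: eqP.
have /tuple_permP[p Ep] : perm_eq v' v.
  by apply/allP=> a _; apply/eqP; rewrite -!cE E.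
have Ev k : mixedLetter I' J' k = mixedLetter I J (p k).
  have := congr1 (fun t => tnth t k) (val_inj Ep : v' = [tuple tnth v (p i) | i < r + s]).
  by rewrite !tnth_mktuple.
by exists p => k; have := Ev k; rewrite /mixedLetter; case: (_ < r)%N; case: (_ < r)%N => // -[-> ->].
Qed.

Section Functional.
Variable phi : index -> index -> K.
Hypothesis phi_perm : forall (p : 'S_(r + s)) I J, (forall k, (p k < r)%N = (k < r)%N) ->
  phi [ffun k => I (p k)] [ffun k => J (p k)] = phi I J.

Let upd (I : index) (l l' : 'I_(r + s)) (i j : 'I_m) : index :=
  [ffun k => if k == l then i else if k == l' then j else I k].

Hypothesis phi_contract : forall (l l' : 'I_(r + s)) I J, (l < r)%N -> (r <= l')%N ->
  (J l == J l')%:R * (\sum_k phi I [ffun a => if a \in [:: l; l'] then k else J a]) =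
  (I l == I l')%:R * (\sum_k phi [ffun a => if a \in [:: l; l'] then k else I a] J).

Let mnms : seq 'X_{1..nvars} := undup [seq mixedMnm u.1 u.2 | u <- enum {: index * index}].
(** Any pair with monomial [w] may be picked, since [phi] is invariant under the permutations
    preserving the wall; the default 0 kills the monomials of other bidegrees. *)
Definition mnmCoef (w : 'X_{1..nvars}) : K :=
  if [pick u : index * index | mixedMnm u.1 u.2 == w] is Some u then phi u.1 u.2 else 0.
Definition mixedFun (f : poly) : K := \sum_(w <- mnms) f@_w * mnmCoef w.

Lemma mnmCoef_mixed I J : mnmCoef (mixedMnm I J) = phi I J.
Proof.
rewrite /mnmCoef; case: pickP => [[I' J'] /= /eqP/esym/mixedMnmP[p pr Ep]|/(_ (I, J))]; last first.
  by rewrite eqxx.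
rewrite -(phi_perm I J pr); congr (phi _ _); apply/ffunP=> k; rewrite ffunE.
  by case: (Ep k).
by case: (Ep k).
Qed.

Lemma mixedFunX w : mixedFun 'X_[w] = mnmCoef w.
Proof.
rewrite /mixedFun; under eq_bigr do rewrite mcoeffX.
have [win|wout] := boolP (w \in mnms).
  rewrite (bigD1_seq w) ?undup_uniq //= eqxx mul1r big1 ?addr0 // => w'.
  by rewrite eq_sym => /negPf->; rewrite mul0r.
rewrite big_seq big1 => [|w' w'in]; last first.
  by case: eqP => [Ew|_]; [rewrite Ew w'in in wout|rewrite mul0r].
rewrite /mnmCoef; case: pickP => // -[I J] /= /eqP Ew; case/negP: wout.
rewrite mem_undup -Ew; apply/mapP; exists (I, J) => //.
by rewrite mem_enum.
Qed.

Lemma mixedFun_is_linear : linear_for *%R mixedFun.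
Proof.
move=> k f g; rewrite /mixedFun mulr_sumr -big_split; apply: eq_bigr => w _ /=.
by rewrite mcoeffD mcoeffZ mulrDl mulrA.
Qed.
HB.instance Definition _ :=
  GRing.isLinear.Build K poly K *%R mixedFun mixedFun_is_linear.

Let x i j : 'I_nvars := mixedVar (true, (i, j)).
Let y i j : 'I_nvars := mixedVar (false, (i, j)).

(** If one of these monomials has a nonzero coefficient, its two last letters occupy positions [l]
    and [l'] of a word. Changing their indices changes the word only there, so one word serves for
    all indices. *)
Lemma mnmCoef_pair w :
  (exists (l l' : 'I_(r + s)) I J, [/\ (l < r)%N, (r <= l')%N & forall i k k' j,
     mnmCoef (w + U_(x i k) + U_(y k' j))%MM = phi (upd I l l' i j) (upd J l l' k k')]) \/
  (forall i k k' j, mnmCoef (w + U_(x i k) + U_(y k' j))%MM = 0).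
Proof.
have [[i [k [k' [j H]]]]|H] := pselect (exists i k k' j,
    mnmCoef (w + U_(x i k) + U_(y k' j))%MM != 0); last first.
  right=> i k k' j; apply/eqP; apply: contra_notT H => H.
  by exists i, k, k', j.
left; move: H; rewrite /mnmCoef; case: pickP; last by rewrite eqxx.
move=> [I J] /= /eqP Ew _.
have occ a : (0 < (w + U_(x i k) + U_(y k' j))%MM (mixedVar a))%N ->
    exists l, mixedLetter I J l = a.
  rewrite -Ew /mixedMnm mnm_sumE lt0n sum_nat_eq0 => /forallPn[l].
  rewrite negb_imply mnm1E /mixedVar (inj_eq enum_rank_inj) eqb0 negbK => /andP[_ /eqP E].
  by exists l.
have [|l El] := occ (true, (i, k)).
  by rewrite !mnmDE mnm1E eqxx addn1 addSn.
have [|l' El'] := occ (false, (k', j)).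
  by rewrite !mnmDE [X in (_ + X)%N]mnm1E eqxx addn1.
move: El El'; rewrite /mixedLetter.
case: (ltnP l r) => // ltlr [Ii Jk]; case: (ltnP l' r) => // lerl' [Jk' Ij].
exists l, l', I, J; split=> // i1 k1 k1' j1; rewrite -mnmCoef_mixed; congr mnmCoef.
have neql : l' != l by apply: contraTneq ltlr => <-; rewrite -leqNgt.
have E I1 J1 : mixedMnm I1 J1 = (U_(x (I1 l) (J1 l)) + (U_(y (J1 l') (I1 l')) +
    \sum_(a | (a != l) && (a != l')) U_(mixedVar (mixedLetter I1 J1 a))))%MM.
  rewrite /mixedMnm (bigD1 l) // (bigD1 l') //=; congr (_ + (_ + _))%MM.
    by rewrite /mixedLetter ltlr.
  by rewrite /mixedLetter ltnNge lerl'.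
move: Ew; rewrite !E Ii Jk Jk' Ij /upd !ffunE !eqxx (negPf neql).
set S := (\big[_/_]_(a | _) _)%MM; set S' := (\big[_/_]_(a | _) _)%MM.
have -> : S' = S.
  apply: eq_bigr => a /andP[/negPf al /negPf al'].
  by rewrite /mixedLetter !ffunE al al'.
move=> Ew; have {Ew} -> : w = S.
  apply/mnmP=> a; move/mnmP/(_ a): Ew; rewrite !mnmDE; lia.
by apply/mnmP=> a; rewrite !mnmDE; lia.
Qed.

Let mixedFun_XY w i j :
  mixedFun ('X_[w] * (varMxX *m varMxY) i j) = \sum_k mnmCoef (w + U_(x i k) + U_(y k j))%MM.
Proof.
rewrite mxE mulr_sumr linear_sum; apply: eq_bigr => k _ /=.
by rewrite !mxE mulrA -!mpolyXD mixedFunX.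
Qed.

Let mixedFun_YX w i j :
  mixedFun ('X_[w] * (varMxY *m varMxX) i j) = \sum_k mnmCoef (w + U_(x k j) + U_(y i k))%MM.
Proof.
rewrite mxE mulr_sumr linear_sum; apply: eq_bigr => k _ /=.
by rewrite !mxE [X in _ * X]mulrC mulrA -!mpolyXD mixedFunX.
Qed.

(** By linearity [f] may be taken to be a monomial; multiplying it by an entry of [XY] or [YX] then
    sums [phi] over a common index at the two positions of [mnmCoef_pair], where [phi_contract]
    applies. *)
Lemma mixedFun_relations f :
  [/\ forall i j, i != j -> mixedFun (f * (varMxX *m varMxY) i j) = 0,
      forall i j, i != j -> mixedFun (f * (varMxY *m varMxX) i j) = 0 &
      forall i j, mixedFun (f * (varMxX *m varMxY) i i) =
                  mixedFun (f * (varMxY *m varMxX) j j)].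
Proof.
have red (g h : poly) : (forall w, mixedFun ('X_[w] * g) = mixedFun ('X_[w] * h)) ->
    mixedFun (f * g) = mixedFun (f * h).
  move=> E; rewrite [f]mpolyE !mulr_suml !linear_sum; apply: eq_bigr => w _ /=.
  by rewrite -!scalerAl !linearZ /= E.
have red0 (g : poly) : (forall w, mixedFun ('X_[w] * g) = 0) -> mixedFun (f * g) = 0.
  by move=> E; rewrite (red g 0) ?mulr0 ?linear0 // => w; rewrite E mulr0 linear0.
(* With [a = b] and [i != j] this kills the off-diagonal entries of [XY]; with [i = j] and [a != b]
   those of [YX]; with both equal it compares diagonal entries. *)
have contract (l l' : 'I_(r + s)) I J i j a b : (l < r)%N -> (r <= l')%N ->
    (b == a)%:R * (\sum_k phi (upd I l l' i j) (upd J l l' k k)) =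
    (i == j)%:R * (\sum_k phi (upd I l l' k k) (upd J l l' b a)).
  move=> ltlr lerl'; have neql : l' != l by apply: contraTneq ltlr => <-; rewrite -leqNgt.
  have := phi_contract (upd I l l' i j) (upd J l l' b a) ltlr lerl'.
  have updd H i1 j1 k : [ffun c => if c \in [:: l; l'] then k else upd H l l' i1 j1 c] =
      upd H l l' k k.
    apply/ffunP=> c; rewrite !ffunE !inE; case: eqP => //= _.
    by case: eqP.
  have updl H i1 j1 : upd H l l' i1 j1 l = i1 by rewrite ffunE eqxx.
  have updl' H i1 j1 : upd H l l' i1 j1 l' = j1 by rewrite ffunE (negPf neql) eqxx.
  rewrite !updl !updl'.
  under eq_bigr do rewrite updd.
  by under [X in _ = _ * X -> _]eq_bigr do rewrite updd.
split=> [i j neqij|i j neqij|i j].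
- apply: red0 => w; rewrite mixedFun_XY.
  case: (mnmCoef_pair w) => [[l [l' [I [J [ltlr lerl' H]]]]]|H]; last by rewrite big1.
  under eq_bigr do rewrite H.
  by have := contract l l' I J i j i i ltlr lerl'; rewrite eqxx mul1r (negPf neqij) mul0r.
- apply: red0 => w; rewrite mixedFun_YX.
  case: (mnmCoef_pair w) => [[l [l' [I [J [ltlr lerl' H]]]]]|H]; last by rewrite big1.
  under eq_bigr do rewrite H.
  have := contract l l' I J i i i j ltlr lerl'.
  by rewrite eqxx mul1r eq_sym (negPf neqij) mul0r.
apply: red => w; rewrite mixedFun_XY mixedFun_YX.
case: (mnmCoef_pair w) => [[l [l' [I [J [ltlr lerl' H]]]]]|H]; last by rewrite !big1.
under eq_bigr do rewrite H; under [RHS]eq_bigr do rewrite H.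
by have := contract l l' I J i i j j ltlr lerl'; rewrite !eqxx !mul1r.
Qed.
End Functional.
End MixedMonomials.

(** Turns congruences modulo a proper ideal into equalities in a commutative ring, as straightening
    requires; it also serves to truncate polynomials in the construction of jets. *)
Lemma quotient_ring_exists (Q : comNzRingType) (J : Q -> Prop) :
  J 0 -> ~ J 1 -> (forall a u v, J u -> J v -> J (a * u + v)) ->
  exists (R : comNzRingType) (f : {rmorphism Q -> R}), forall x, f x = 0 <-> J x.
Proof.
move=> J0 J1 Jlin; pose JP : {pred Q} := fun x => `[< J x >].
have Jideal : idealr_closed JP.
  split; [exact/asboolP|exact/asboolP|].
  by move=> a u v /asboolP Ju /asboolP Jv; apply/asboolP/Jlin.
pose JI : idealr Q := HB.pack_for (idealr Q) JP (isIdealr.Build Q JP Jideal).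
exists {ideal_quot JI}, \pi_{ideal_quot JI}%qT => x.
have := Quotient.idealrBE JI x 0; rewrite subr0 => E.
split=> [f0|Jx].
  by apply/asboolP; rewrite -[`[< _ >]]/(x \in JI) E -[X in _ == X]/(\pi%qT 0) f0 rmorph0.
have xJ : x \in JI by apply/asboolP.
by rewrite E in xJ; apply: etrans (eqP xJ) (rmorph0 _).
Qed.

Lemma tabValue_map (R R' : comNzRingType) (f : {rmorphism R -> R'}) (m r s : nat)
    (X Y : 'M[R]_m) t (T : {ffun 'I_(s + r) -> {ffun 'I_m -> 'I_(m + m)}}) :
  f (tabValue X Y t T) = tabValue (map_mx f X) (map_mx f Y) (f t) T.
Proof.
rewrite /tabValue rmorphM rmorphXn rmorph_prod; congr (_ * _).
apply: eq_bigr => c _; rewrite /tabMinor -det_map_mx map_mxsub; congr (\det (colsub _ _)).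
by rewrite /graphMx; case: ifP => _; rewrite map_row_mx map_scalar_mx rmorph1.
Qed.

Lemma det_replace_col (R : comNzRingType) n (l0 : 'I_n) (u : 'I_n -> R) :
  \det (\matrix_(i, l) (if l == l0 then u i else (i == l)%:R)) = u l0.
Proof.
rewrite /determinant (bigD1 1%g) //= odd_perm1 expr0 mul1r [X in _ + X]big1 ?addr0 => [|p p1].
  rewrite (bigD1 l0) //= mxE perm1 eqxx big1 ?mulr1 // => i /negPf neqi.
  by rewrite mxE perm1 neqi eqxx.
have [i pi pl0] : exists2 i, p i != i & p i != l0.
  have [i0 pi0] : exists i, p i != i.
    apply/existsP; apply: contraNT p1 => /existsPn p1; apply/eqP/permP=> i.
    by rewrite perm1; apply/eqP; move: (p1 i); rewrite negbK.
  have [E|] := eqVneq (p i0) l0; last by exists i0.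
  by exists l0; rewrite -{2}E (inj_eq perm_inj) -E.
by rewrite (bigD1 i) //= mxE (negPf pl0) eq_sym (negPf pi) mul0r mulr0.
Qed.

(** * Mixed monomials as products of minors *)

Section MixedTableau.
Variables (R : comNzRingType) (m r s : nat) (X Y : 'M[R]_m) (t : R).
Implicit Types I J : {ffun 'I_(r + s) -> 'I_m}.

(** Replacing one column of the identity block by a column of the other block gives a minor equal to
    a single entry of [X] or [Y]. Mixed monomials thus are values of tableaux, with no power of
    [t]. *)
Definition mixedTab m r s (I J : {ffun 'I_(r + s) -> 'I_m}) :
    {ffun 'I_(s + r) -> {ffun 'I_m -> 'I_(m + m)}} :=
  [ffun c => match split c with
    | inl k => [ffun l => if l == J (rshift r k) then rshift m (I (rshift r k)) else lshift m l]
    | inr k => [ffun l => if l == I (lshift s k) then lshift m (J (lshift s k)) else rshift m l]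
    end].

Lemma mixedTab_l I J k : mixedTab I J (lshift r k) =
  [ffun l => if l == J (rshift r k) then rshift m (I (rshift r k)) else lshift m l].
Proof. by rewrite ffunE (unsplitK (inl k)). Qed.
Lemma mixedTab_r I J k : mixedTab I J (rshift s k) =
  [ffun l => if l == I (lshift s k) then lshift m (J (lshift s k)) else rshift m l].
Proof. by rewrite ffunE (unsplitK (inr k)). Qed.

Lemma nbLow_l I J k : nbLow (mixedTab I J (lshift r k)) = m.-1.
Proof.
rewrite mixedTab_l /nbLow (bigD1 (J (rshift r k))) //= ffunE eqxx /= ltnNge leq_addr add0n.
under eq_bigr => l /negPf neql do rewrite ffunE neql /= ltn_ord.
rewrite sum1_card -[in RHS](card_ord m) -cardsT (cardsD1 (J (rshift r k))) inE /=.
by apply: eq_card => l; rewrite !inE andbT.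
Qed.

Lemma nbLow_r I J k : nbLow (mixedTab I J (rshift s k)) = 1%N.
Proof.
rewrite mixedTab_r /nbLow (bigD1 (I (lshift s k))) //= ffunE eqxx /= ltn_ord.
by rewrite big1 // => l /negPf neql; rewrite ffunE neql /= ltnNge leq_addr.
Qed.

Lemma mixedTab_xDegree I J : xDegree (mixedTab I J) = r.
Proof.
rewrite /xDegree big_split_ord /= big_pred0 ?add0n => [|c]; last by rewrite leqNgt ltn_ord.
rewrite -[RHS]card_ord -sum1_card; apply: eq_big => [c|c _]; first by rewrite leq_addr.
exact: nbLow_r.
Qed.

Lemma mixedTab_total I J : (\sum_c nbLow (mixedTab I J c) = r + m.-1 * s)%N.
Proof.
rewrite big_split_ord /= addnC; congr (_ + _)%N.
  by under eq_bigr do rewrite nbLow_r; rewrite sum1_card card_ord.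
by under eq_bigr do rewrite nbLow_l; rewrite sum_nat_const card_ord mulnC.
Qed.

Lemma mixedTab_value I J : tabValue X Y t (mixedTab I J) =
  \prod_(k < r + s) (if (k < r)%N then X (I k) (J k) else Y (J k) (I k)).
Proof.
rewrite /tabValue mixedTab_xDegree subnn expr0 mul1r !big_split_ord /= mulrC.
congr (_ * _); apply: eq_bigr => k _.
- rewrite ltn_ord /tabMinor /graphMx /= ltnNge leq_addr mixedTab_r /=.
  rewrite -(det_replace_col (I (lshift s k)) (fun i => X i (J (lshift s k)))).
  congr (\det _); apply/matrixP=> i l; rewrite mxE ffunE [RHS]mxE.
  by case: eqP => _; rewrite ?row_mxEl // row_mxEr mxE.
- rewrite [in RHS]ltnNge leq_addr /tabMinor /graphMx /= ltn_ord mixedTab_l.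
  rewrite -(det_replace_col (J (rshift r k)) (fun i => Y i (I (rshift r k)))).
  congr (\det _); apply/matrixP=> i l; rewrite mxE ffunE [RHS]mxE.
  by case: eqP => _; rewrite ?row_mxEr // row_mxEl mxE.
Qed.
End MixedTableau.

Lemma nonzero_eval (K : fieldType) (p : {poly K}) :
  (forall S : seq K, exists x : K, x \notin S) -> p != 0 -> exists x, p.[x] != 0.
Proof.
move=> K_infinite p0; have longs n : exists2 S : seq K, size S = n & uniq S.
  elim: n => [|n [S szS uS]]; first by exists [::].
  by have [x xS] := K_infinite S; exists (x :: S); rewrite /= ?szS ?xS.
have [S szS uS] := longs (size p).
have [/allP S_roots|/allPn[x _ px]] := boolP (all (root p) S); last by exists x.
by have := max_poly_roots p0 (introT allP S_roots) uS; rewrite szS ltnn.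
Qed.

(** * Forms vanishing on the group are killed by the functional *)

Section FunctionalVanishing.
Variables (K : fieldType) (m r s : nat).
Hypotheses (K_infinite : forall S : seq K, exists x : K, x \notin S) (m_gt0 : (0 < m)%N).
Local Notation index := {ffun 'I_(r + s) -> 'I_m}.
Local Notation poly := {mpoly K[#|{: bool * ('I_m * 'I_m)}|]}.

Let C := powerMx K m r s.
Let A := lsubmx C.
Let B := rsubmx C.

Let detA : \det A != 0.
Proof.
have -> : A = colsub (lshift m) C by apply/matrixP=> i j; rewrite !mxE.
by rewrite -size_poly_gt0 size_minor_powerMx.
Qed.
Let detB : \det B != 0.
Proof.
have -> : B = colsub (@rshift m m) C by apply/matrixP=> i j; rewrite !mxE.
by rewrite -size_poly_gt0 size_minor_powerMx // => i j ltij; rewrite /= ltn_add2l.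
Qed.

Let toPoly (v : bool * ('I_m * 'I_m)) : {poly K} :=
  if v.1 then (\adj B *m A) v.2.1 v.2.2 else (\adj A *m B) v.2.1 v.2.2.
Let psi : {rmorphism poly -> {poly K}} :=
  mmap (@polyC K) (fun i => toPoly (enum_val i)).

Let psiX : map_mx psi (varMxX K m) = \adj B *m A.
Proof.
apply/matrixP=> i j; rewrite mxE /varMxX mxE /psi /= mmapX mmap1U /mixedVar enum_rankK.
by [].
Qed.
Let psiY : map_mx psi (varMxY K m) = \adj A *m B.
Proof.
apply/matrixP=> i j; rewrite mxE /varMxY mxE /psi /= mmapX mmap1U /mixedVar enum_rankK.
by [].
Qed.
Let psiC c : psi c%:MP = c%:P.
Proof. by rewrite /psi /= mmapC. Qed.

Variables (phi : index -> index -> K) (a : index -> index -> K).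
Hypothesis phi_perm : forall (p : 'S_(r + s)) (I J : index), (forall k, (p k < r)%N = (k < r)%N) ->
  phi [ffun k => I (p k)] [ffun k => J (p k)] = phi I J.
Hypothesis phi_contract : forall (l l' : 'I_(r + s)) (I J : index), (l < r)%N -> (r <= l')%N ->
  (J l == J l')%:R * (\sum_k phi I [ffun a => if a \in [:: l; l'] then k else J a]) =
  (I l == I l')%:R * (\sum_k phi [ffun a => if a \in [:: l; l'] then k else I a] J).
Hypothesis a_group : forall g : 'M_m, g \in unitmx ->
  \sum_I \sum_J a I J *
    \prod_(k < r + s) (if (k < r)%N then g (I k) (J k) else invmx g (J k) (I k)) = 0.

(** Otherwise, as [K] is infinite, the sum is nonzero at some point where [det A] and [det B] are
    nonzero too. With [g = B^-1 A] there, [adj(B) A] and [adj(A) B] are [g] and [g^-1] up to the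
    scalars [det B] and [det A], so [a_group] applies. *)
Let a_adj : \sum_I \sum_J (a I J)%:P * \prod_(k < r + s)
    (if (k < r)%N then (\adj B *m A) (I k) (J k) else (\adj A *m B) (J k) (I k)) = 0.
Proof.
set h := (X in X = _).
apply/eqP; suff : h * (\det A * \det B) == 0.
  by rewrite mulf_eq0 mulf_eq0 (negPf detA) (negPf detB) !orbF.
apply: contraT => /(nonzero_eval K_infinite)[x]; rewrite !hornerM.
rewrite !mulf_eq0 !negb_or => /and3P[/eqP hx dA dB]; case: hx.
pose ev : {rmorphism {poly K} -> K} := horner_eval x.
have evC c : ev c%:P = c by rewrite /ev /= /horner_eval hornerC.
pose A0 := map_mx ev A; pose B0 := map_mx ev B.
have uA : A0 \in unitmx by rewrite unitmxE det_map_mx unitfE.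
have uB : B0 \in unitmx by rewrite unitmxE det_map_mx unitfE.
pose g := invmx B0 *m A0.
have ug : g \in unitmx by rewrite unitmx_mul unitmx_inv uB uA.
have gV : invmx g = invmx A0 *m B0.
  by rewrite -[RHS](mulKmx ug) [g *m _]mulmxA mulmxK // mulVmx // mulmx1.
have adjE (M : 'M[K]_m) : M \in unitmx -> \adj M = \det M *: invmx M.
  move=> uM; rewrite /invmx uM scalerA divff ?scale1r //.
  by rewrite -unitfE -unitmxE.
have ag := a_group ug.
rewrite -[h.[x]]/(ev h) rmorph_sum /=.
transitivity (\det B0 ^+ r * \det A0 ^+ s * \sum_I \sum_J a I J *
    \prod_(k < r + s) (if (k < r)%N then g (I k) (J k) else invmx g (J k) (I k))); last first.
  by rewrite ag mulr0.
rewrite mulr_sumr; apply: eq_bigr => I _; rewrite rmorph_sum mulr_sumr.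
apply: eq_bigr => J _; rewrite rmorphM rmorph_prod evC mulrCA.
congr (_ * _).
have -> : \det B0 ^+ r * \det A0 ^+ s = \prod_(k < r + s) (if (k < r)%N then \det B0 else \det A0).
  rewrite big_split_ord /=; congr (_ * _).
    by under eq_bigr do rewrite ltn_ord; rewrite prodr_const card_ord.
  by under eq_bigr do rewrite ltnNge leq_addr; rewrite prodr_const card_ord.
rewrite -big_split; apply: eq_bigr => k _ /=; case: ifP => _.
  transitivity ((map_mx ev (\adj B *m A)) (I k) (J k)); first by rewrite [RHS]mxE.
  by rewrite map_mxM map_mx_adj -/A0 -/B0 adjE // -scalemxAl mxE.
transitivity ((map_mx ev (\adj A *m B)) (J k) (I k)); first by rewrite [RHS]mxE.
by rewrite map_mxM map_mx_adj -/A0 -/B0 adjE // -scalemxAl gV mxE.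
Qed.

(** Modulo an ideal killed by [psi] and [L], straightening turns the form into a combination of
    standard values. As [psi] kills the form, independence makes all coefficients zero, so [L] kills
    the form as well. *)
Lemma functional_vanishing : \sum_I \sum_J a I J * phi I J = 0.
Proof.
pose i0 := Ordinal m_gt0; pose X := varMxX K m; pose Y := varMxY K m.
pose t := (X *m Y) i0 i0; pose L : {scalar poly} := mixedFun phi.
(* The number of low entries for which a value of degree [r] in [X] has degree [s] in [Y]. *)
pose n := (r + m.-1 * s)%N.
pose ok (S : {ffun 'I_(s + r) -> {ffun 'I_m -> 'I_(m + m)}}) :=
  [&& tabStandard S, (xDegree S <= r)%N & (\sum_c nbLow (S c) == n)%N].
have [psiXY psiYX] := adj_graph_mul A B.
have psit : psi t = \det A * \det B.
  transitivity (map_mx psi (X *m Y) i0 i0); first by rewrite [RHS]mxE.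
  by rewrite map_mxM psiX psiY psiXY mxE eqxx mulr1n.
(* The largest ideal killed by both [psi] and [L]. *)
pose J f := psi f = 0 /\ forall g, L (g * f) = 0.
have J0 : J 0 by split=> [|g]; rewrite ?mulr0 ?linear0 ?rmorph0.
have J1 : ~ J 1 by case=> /eqP; rewrite rmorph1 oner_eq0.
have JL b u v : J u -> J v -> J (b * u + v).
  move=> [pu Lu] [pv Lv]; split=> [|g]; first by rewrite rmorphD rmorphM pu pv mulr0 addr0.
  by rewrite mulrDr mulrA linearD /= Lu Lv addr0.
have [R [pi piJ]] := quotient_ring_exists J0 J1 JL.
have eq_pi u v : J (u - v) -> pi u = pi v.
  by move/piJ/eqP; rewrite rmorphB subr_eq0 => /eqP.
have rel M : map_mx psi M = (\det A * \det B)%:M ->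
    (forall g i j, i != j -> L (g * M i j) = 0) -> (forall g i, L (g * M i i) = L (g * t)) ->
    map_mx pi M = (pi t)%:M.
  move=> psiM Lij Lii; apply/matrixP=> i j; rewrite !mxE -rmorphMn; apply: eq_pi.
  have psiMij : psi (M i j) = (\det A * \det B) *+ (i == j).
    by have /matrixP/(_ i j) := psiM; rewrite !mxE.
  split=> [|g]; first by rewrite rmorphB rmorphMn psiMij psit subrr.
  rewrite mulrBr linearB /=; have [<-|neqij] := eqVneq i j.
    by rewrite mulr1n Lii subrr.
  by rewrite mulr0n mulr0 linear0 subr0 Lij.
have Lrel g := mixedFun_relations phi_perm phi_contract g.
have XY : map_mx pi X *m map_mx pi Y = (pi t)%:M.
  rewrite -map_mxM; apply: rel => [|g i j neqij|g i].
  - by rewrite map_mxM psiX psiY.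
  - by have [H _ _] := Lrel g; apply: H.
  - by have [_ _ H] := Lrel g; rewrite /L /= (H i i0) -(H i0 i0).
have YX : map_mx pi Y *m map_mx pi X = (pi t)%:M.
  rewrite -map_mxM; apply: rel => [|g i j neqij|g i].
  - by rewrite map_mxM psiX psiY.
  - by have [_ H _] := Lrel g; apply: H.
  - by have [_ _ H] := Lrel g; rewrite /L /= -(H i0 i).
(* Combinations are formed in the polynomial ring and then reduced, so that [psi] and [L] can be
   applied to them. *)
pose span z := exists2 c : {ffun 'I_(s + r) -> {ffun 'I_m -> 'I_(m + m)}} -> K,
  forall S, ~~ ok S -> c S = 0 & z = pi (\sum_S (c S)%:MP * tabValue X Y t S).
have span0 : span 0.
  exists (fun=> 0) => //; rewrite big1 ?rmorph0 // => S _.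
  by rewrite mul0r.
have spanL k z z' : span z -> span z' -> span (pi k%:MP * z + z').
  move=> [c c0 ->] [c' c'0 ->]; exists (fun S => k * c S + c' S) => [S nS|].
    by rewrite c0 // c'0 // mulr0 addr0.
  rewrite -rmorphM -rmorphD mulr_sumr -big_split; congr (pi _); apply: eq_bigr => S _ /=.
  by rewrite mpolyCD mpolyCM mulrDl mulrA.
have spanB z z' : span z -> span z' -> span (z - z').
  move=> sz sz'; have := spanL (-1) _ _ sz' sz.
  by rewrite mpolyCN mpolyC1 rmorphN1 mulN1r addrC.
have span_tab (I I' : index) : span (tabValue (map_mx pi X) (map_mx pi Y) (pi t) (mixedTab I I')).
  apply: (tab_straightening XY YX span0 spanB) (mixedTab_total I I') => [S S_std S_adm S_tot|].
    have S_ok : ok S by rewrite /ok S_std S_adm S_tot /=.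
    exists (fun U => (U == S)%:R) => [U|].
      by case: eqP => [->|//]; rewrite S_ok.
    rewrite (bigD1 S) //= eqxx mpolyC1 mul1r big1 ?addr0 ?tabValue_map // => U /negPf->.
    by rewrite mulr0n mpolyC0 mul0r.
  by rewrite mixedTab_xDegree.
pose f : poly := \sum_I \sum_I' (a I I')%:MP * tabValue X Y t (mixedTab I I').
have [c c0 fE] : span (pi f).
  rewrite rmorph_sum; apply: (big_ind span) => // [z z' sz sz'|I _].
    by rewrite -[z]mul1r -(rmorph1 pi) -mpolyC1; apply: spanL.
  rewrite rmorph_sum; apply: (big_ind span) => // [z z' sz sz'|I' _].
    by rewrite -[z]mul1r -(rmorph1 pi) -mpolyC1; apply: spanL.
  by rewrite rmorphM tabValue_map -[_ * _]addr0; apply: spanL.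
have Jf : J (f - \sum_S (c S)%:MP * tabValue X Y t S).
  by apply/piJ; rewrite rmorphB fE subrr.
have psif : psi f = 0.
  rewrite /f rmorph_sum -[RHS]a_adj; apply: eq_bigr => I _; rewrite rmorph_sum.
  apply: eq_bigr => I' _; rewrite rmorphM psiC; congr (_ * _).
  by rewrite tabValue_map psiX psiY mixedTab_value.
have {}c0 S : c S = 0.
  have [/and3P[S_std _ _]|] := boolP (ok S); last exact: c0.
  apply: (standard_minors_free _ S_std).
  have [+ _] := Jf; rewrite rmorphB psif sub0r => /eqP; rewrite oppr_eq0 => /eqP; apply: etrans.
  rewrite rmorph_sum [LHS]big_mkcond; apply: eq_bigr => U _ /=.
  rewrite rmorphM psiC tabValue_map psiX psiY psit.
  have [/and3P[U_std U_adm /eqP U_tot]|nU] := boolP (ok U); last first.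
    by rewrite c0 // polyC0 !mul0r if_same.
  by rewrite U_std tabValue_graph // hsubmxK.
have [_ /(_ 1)] := Jf.
rewrite mul1r big1 ?subr0 => [Lf|S _]; last by rewrite c0 mpolyC0 mul0r.
apply: etrans Lf; rewrite /f linear_sum; apply: eq_bigr => I _.
rewrite linear_sum; apply: eq_bigr => I' _.
rewrite mul_mpolyC linearZ /=; congr (_ * _).
rewrite mixedTab_value -(mnmCoef_mixed phi_perm) -(mixedFunX _ (mixedMnm I I')).
congr (mixedFun _ _).
rewrite /mixedMnm -mprodXE; apply: eq_bigr => k _; rewrite /mixedLetter.
by case: ifP => _; rewrite mxE.
Qed.
End FunctionalVanishing.

(** * Distributions *)

(** A finite family of maximal rank spans all [w x], even for infinite [S]; if [v] were outside its
    row space, a column of the cokernel matrix would separate them. *)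
Lemma span_separation (K : fieldType) (n : nat) (S : Type) (w : S -> 'rV[K]_n) (v : 'rV[K]_n) :
  (forall a : 'cV_n, (forall x, w x *m a = 0) -> v *m a = 0) ->
  exists k (x : 'I_k -> S) (c : 'I_k -> K), v = \sum_i c i *: w (x i).
Proof.
move=> sep; pose rk d := `[< exists k (x : 'I_k -> S), \rank (\matrix_i w (x i)) = d >].
have rk0 : exists d, rk d.
  exists 0%N; apply/asboolP; exists 0%N.
  have x0 : 'I_0 -> S by case.
  by exists x0; apply/eqP; rewrite -leqn0 rank_leq_row.
have rk_le d : rk d -> (d <= n)%N by move=> /asboolP[k [x <-]]; apply: rank_leq_col.
case: (ex_maxnP rk0 rk_le) => d /asboolP[k [x dE]] d_max.
pose M := \matrix_i w (x i).
have wM y : (w y <= M)%MS.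
  pose x' (i : 'I_(1 + k)) := match split i with inl _ => y | inr j => x j end.
  have M'E : \matrix_i w (x' i) = col_mx (w y) M.
    apply/row_matrixP=> i; rewrite rowK /x'; case: (split_ordP i) => j ->.
      rewrite rowKu; apply/rowP=> l; rewrite !mxE.
      by congr (w y _ _); rewrite ord1.
    by rewrite rowKd rowK.
  have := d_max (\rank (\matrix_i w (x' i))).
  have -> : rk (\rank (\matrix_i w (x' i))) by apply/asboolP; exists (1 + k)%N, x'.
  move=> /(_ isT); rewrite M'E -dE -/M => le_rank.
  have subM : (M <= col_mx (w y) M)%MS by rewrite -addsmxE addsmxSr.
  have := mxrank_leqif_sup subM; case=> _ /esym; rewrite eqn_leq le_rank mxrankS // => sub.
  by apply: submx_trans sub; rewrite -addsmxE addsmxSl.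
have vM : (v <= M)%MS.
  rewrite submxE; apply/eqP/matrixP=> i j.
  have colE (u : 'rV_n) : (u *m col j (cokermx M)) 0 0 = (u *m cokermx M) 0 j.
    by rewrite !mxE; apply: eq_bigr => l _; rewrite mxE.
  rewrite ord1 -colE sep ?mxE // => y; apply/matrixP=> i' j'; rewrite !ord1 colE.
  by have := wM y; rewrite submxE => /eqP->; rewrite !mxE.
have /submxP[c ->] := vM; exists k, x, (fun i => c 0 i).
by rewrite mulmx_sum_row; apply: eq_bigr => i _; rewrite rowK.
Qed.

Section Jets.
Variables (K : fieldType) (m : nat) (z : 'M[K]_m).

Definition lineMx : 'M[{poly K}]_m := 1%:M + 'X *: map_mx polyC z.
Definition alongLine (p : {mpoly K[m * m]}) : {poly K} :=
  mmap (@polyC K) (fun k => mxvec lineMx 0 k) p.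
HB.instance Definition _ := GRing.RMorphism.copy alongLine
  (mmap (@polyC K) (fun k => mxvec lineMx 0 k)).

Lemma alongLineC c : alongLine c%:MP = c%:P.
Proof. exact: mmapC. Qed.

Lemma alongLine_eval p x : (alongLine p).[x] = evalMx (1%:M + x *: z) p.
Proof.
rewrite /alongLine /evalMx mevalE /mmap horner_sum; apply: eq_bigr => u _.
rewrite hornerM hornerC /mmap1 horner_prod; congr (_ * _); apply: eq_bigr => k _.
rewrite horner_exp; congr (_ ^+ _); case/mxvec_indexP: k => i j; rewrite !mxvecE !mxE.
by rewrite hornerD hornerM hornerX hornerC hornerMn hornerC.
Qed.

Lemma alongLine_coef0 p : (alongLine p)`_0 = evalMx 1%:M p.
Proof. by rewrite -horner_coef0 alongLine_eval scale0r addr0. Qed.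

(** The functional is the coefficient of degree [d] of [f] along [1 + eps z], where the determinant
    has constant term 1 and so is invertible modulo degree [d + 1]. Functions vanishing at the
    identity become multiples of [eps], hence the first claim; dividing by a series of constant term
    1 keeps the lowest coefficient, hence the second. *)
Lemma jet_exists (d : nat) : exists del : {scalar coordGL K m},
  (forall n f, (d < n)%N -> augIdealPow n f -> del f = 0) /\
  (forall f p k, coordGL_val f = tofrac p / tofrac (detPoly K m) ^+ k ->
     (forall i, (i < d)%N -> (alongLine p)`_i = 0) -> del f = (alongLine p)`_d).
Proof.
pose D := alongLine (detPoly K m).
have D0 : D`_0 = 1 by rewrite alongLine_coef0 evalMx_det det1.
(* [q] inverts [D] modulo [X^(d+1)], by the geometric series in [1 - D], which has no constant
   term. *)
have [q qD] : exists q : {poly K}, dvdp 'X^(d.+1) (q * D - 1).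
  exists (\sum_(i < d.+1) (1 - D) ^+ i).
  have -> : (\sum_(i < d.+1) (1 - D) ^+ i) * D - 1 = - (1 - D) ^+ d.+1.
    have := subrXX (1 : {poly K}) (1 - D) d.+1.
    rewrite expr1n opprB addrCA subrr addr0 mulrC.
    under eq_bigr do rewrite expr1n mul1r.
    by move=> <-; rewrite addrAC subrr add0r.
  have /factor_theorem[h hE] : root (1 - D) 0.
    by rewrite /root hornerD hornerN hornerC horner_coef0 D0 subrr.
  by rewrite hE subr0 exprMn dvdpNr dvdp_mull.
have q0 : q`_0 = 1.
  have := dvdp_trans (dvdp_exp2l 'X (ltn0Sn d)) qD; rewrite expr1 -['X]subr0 dvdp_XsubCl.
  by rewrite /root hornerD hornerN hornerC hornerM !horner_coef0 D0 mulr1 subr_eq0 => /eqP.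
have [Rq [pi piE]] : exists (Rq : comNzRingType) (pi : {rmorphism {poly K} -> Rq}),
    forall u, pi u = 0 <-> dvdp 'X^(d.+1) u.
  apply: quotient_ring_exists => [|X1|a u v ud vd]; first exact: dvdp0.
    by move: X1; rewrite dvdp1 size_polyXn.
  by rewrite dvdp_addr // dvdp_mull.
have pi_coef u v : pi u = pi v -> u`_d = v`_d.
  move/eqP; rewrite -subr_eq0 -rmorphB => /eqP/piE/dvdpP[h E].
  by rewrite -[u](subrK v) E coefD coefMXn ltnSn add0r.
have piqD : pi q * pi D = 1.
  by apply/eqP; rewrite -rmorphM -subr_eq0 -(rmorph1 pi) -rmorphB; apply/eqP/piE.
have qDk l : (pi q * pi D) ^+ l = 1 by rewrite piqD expr1n.
pose den : {fraction {mpoly K[m * m]}} := tofrac (detPoly K m).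
have den0 k : den ^+ k != 0 by rewrite expf_neq0 // tofrac_eq0 detPoly_neq0.
(* Independence of the fraction chosen for [f]: cross-multiply and cancel [D] against [q]. *)
have rep (f : coordGL K m) : exists h : {poly K}, forall p k,
    coordGL_val f = tofrac p / den ^+ k -> pi h = pi (alongLine p * q ^+ k).
  have /asboolP[p [k fE]] := coordGL_valP f.
  exists (alongLine p * q ^+ k) => p' k'; rewrite fE => /eqP.
  rewrite eqr_div ?den0 // -!tofracXn -!tofracM tofrac_eq => /eqP E.
  have {}E : pi (alongLine p) * pi D ^+ k' = pi (alongLine p') * pi D ^+ k.
    by rewrite -!rmorphXn -!rmorphM /= E.
  rewrite !rmorphM !rmorphXn.
  rewrite -[LHS]mulr1 -(qDk k') -[RHS]mulr1 -(qDk k) !exprMn.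
  transitivity (pi (alongLine p) * pi D ^+ k' * (pi q ^+ k * pi q ^+ k')).
    by rewrite -!mulrA; congr (_ * _); rewrite [RHS]mulrC -mulrA.
  by rewrite E -!mulrA; congr (_ * _); rewrite mulrC -mulrA mulrCA.
(* The chosen representatives are compatible with sums and products only modulo [X^(d+1)], which
   suffices for the coefficient of degree [d]. *)
have [h hE] : exists h : coordGL K m -> {poly K}, forall f p k,
    coordGL_val f = tofrac p / den ^+ k -> pi (h f) = pi (alongLine p * q ^+ k).
  by exists (fun f => sval (cid (rep f))) => f; apply: svalP (cid (rep f)).
have repr f : exists p k, coordGL_val f = tofrac p / den ^+ k by apply/asboolP/coordGL_valP.
have hD f g : pi (h (f + g)) = pi (h f) + pi (h g).
  have [p [k fE]] := repr f; have [p' [k' gE]] := repr g.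
  have fgE : coordGL_val (f + g) =
      tofrac (p * detPoly K m ^+ k' + p' * detPoly K m ^+ k) / den ^+ (k + k').
    rewrite (_ : coordGL_val (f + g) = coordGL_val f + coordGL_val g) // fE gE addf_div // exprD.
    by rewrite tofracD !tofracM !tofracXn.
  rewrite (hE _ _ _ fgE) (hE _ _ _ fE) (hE _ _ _ gE) !rmorphM !rmorphD !rmorphM !rmorphXn /=.
  rewrite -/D exprD mulrDl; congr (_ + _); rewrite -mulrA; congr (_ * _).
    by rewrite mulrCA -exprMn [pi D * _]mulrC qDk mulr1.
  by rewrite mulrA -exprMn [pi D * _]mulrC qDk mul1r.
have hM f g : pi (h (f * g)) = pi (h f) * pi (h g).
  have [p [k fE]] := repr f; have [p' [k' gE]] := repr g.
  have fgE : coordGL_val (f * g) = tofrac (p * p') / den ^+ (k + k').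
    by rewrite (_ : coordGL_val (f * g) = coordGL_val f * coordGL_val g) // fE gE mulf_div exprD tofracM.
  rewrite (hE _ _ _ fgE) (hE _ _ _ fE) (hE _ _ _ gE) exprD !rmorphM /=.
  by rewrite mulrACA.
have h1 : pi (h 1) = 1.
  have E1 : coordGL_val (1 : coordGL K m) = tofrac 1 / den ^+ 0 by rewrite expr0 divr1 tofrac1.
  by rewrite (hE _ _ _ E1) expr0 mulr1 /= !rmorph1.
have hC c : pi (h (polyGL c%:MP)) = pi c%:P.
  have E1 : coordGL_val (polyGL c%:MP : coordGL K m) = tofrac c%:MP / den ^+ 0.
    by rewrite expr0 divr1.
  by rewrite (hE _ _ _ E1) expr0 mulr1 /= alongLineC.
have del_lin : linear_for *%R (fun f => (h f)`_d).
  move=> c f g; have -> : c * (h f)`_d + (h g)`_d = (c%:P * h f + h g)`_d.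
    by rewrite coefD coefCM.
  by apply: pi_coef; rewrite hD -[c *: f]/(polyGL c%:MP * f) hM hC rmorphD rmorphM.
pose del : {scalar coordGL K m} := HB.pack_for {scalar coordGL K m} (fun f => (h f)`_d)
  (GRing.isLinear.Build K (coordGL K m) K *%R (fun f => (h f)`_d) del_lin).
exists del; split=> [n f ltdn [N [g [g_aug ->]]]|f p k fE lowp].
  have h0 : pi (h 0) = 0.
    by apply: (addrI (pi (h 0))); rewrite -hD !addr0.
  have [u uE] : exists u : 'I_N -> 'I_n -> Rq, forall a b, pi (h (g a b)) = u a b * pi 'X.
    have aug a b : exists u, pi (h (g a b)) = u * pi 'X.
      have [p [k [p0 gE]]] := g_aug a b; have /factor_theorem[v vE] : root (alongLine p) 0.
        by rewrite /root alongLine_eval scale0r addr0 p0.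
      exists (pi (v * q ^+ k)); rewrite (hE _ _ _ gE) vE subr0 -rmorphM; congr (pi _).
      by rewrite mulrAC.
    by exists (fun a b => sval (cid (aug a b))) => a b; apply: svalP (cid (aug a b)).
  rewrite -[RHS](@coef0 K d); apply: (pi_coef (h _) 0); rewrite rmorph0.
  have h_sum (F : 'I_N -> coordGL K m) : pi (h (\sum_a F a)) = \sum_a pi (h (F a)).
    exact: (big_morph (pi \o h) hD h0).
  have h_prod (F : 'I_n -> coordGL K m) : pi (h (\prod_b F b)) = \prod_b pi (h (F b)).
    exact: (big_morph (pi \o h) hM h1).
  rewrite h_sum; apply: big1 => a _; rewrite h_prod.
  under eq_bigr do rewrite uE.
  rewrite big_split prodr_const card_ord -rmorphXn /= [pi 'X^n](_ : _ = 0) ?mulr0 //.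
  by apply/piE; rewrite dvdp_exp2l.
rewrite [LHS](pi_coef _ _ (hE _ _ _ fE)).
rewrite -[alongLine p](poly_take_drop d) [take_poly _ _](_ : _ = 0); last first.
  by apply/polyP=> i; rewrite coef_take_poly coef0; case: ifP => // /lowp.
rewrite add0r mulrAC coefMXn ltnn subnn coefMXn ltnn subnn coef0M.
have -> : (q ^+ k)`_0 = 1 by elim: k {fE} => [|k IHk]; rewrite ?expr0 ?coef1 // exprS coef0M IHk q0 mulr1.
by rewrite mulr1.
Qed.
End Jets.

(** * Diagrams and the group action *)

Section DiagramInvariance.
Variables (R : comNzRingType) (m r s : nat) (g h : 'M[R]_m).
Hypotheses (m_gt0 : (0 < m)%N) (gh : g *m h = 1%:M) (hg : h *m g = 1%:M).
Variable D : diagram r s.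
Local Notation vertex := (vertex r s).
Local Notation index := {ffun 'I_(r + s) -> 'I_m}.

Let side (v : vertex) : bool := v.1 (+) leftOfWall v.

Let sideD v : side (D v) = ~~ side v.
Proof. by have /isDiagramP[_ _ sD] := diagram_valP D; apply: sD. Qed.

Let compat (l : {ffun vertex -> 'I_m}) := [forall v, l (D v) == l v].
Let factor (l' l : {ffun vertex -> 'I_m}) v : R :=
  if side v then h (l v) (l' v) else g (l' v) (l v).

(* Every edge joins a vertex carrying [g] to one carrying [h = g^-1]. *)
Lemma sum_compatible_labels l' :
  \sum_(l | compat l) \prod_v factor l' l v = (compat l')%:R.
Proof.
pose a0 : 'I_m := Ordinal m_gt0.
pose G v a := g (l' v) a * h a (l' (D v)).
have DK := diagramK D.
(* Each edge is represented by its end outside [side], which collects the entry of [g] there and the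
   entry of [h] at the other end. *)
transitivity (\sum_(l | compat l) \prod_(v | ~~ side v) G v (l v)).
  apply: eq_bigr => l /forallP lD; rewrite (bigID side) /= mulrC.
  rewrite [X in _ * X](reindex_inj (inv_inj DK)) /=.
  rewrite [X in _ * X](eq_bigl (fun v => ~~ side v)) => [|v]; last exact: sideD.
  rewrite -big_split; apply: eq_bigr => v /= nv.
  by rewrite /factor sideD (negPf nv) /= (eqP (lD v)).
transitivity (\prod_(v | ~~ side v) \sum_a G v a).
  (* A compatible labelling is a free choice of labels at these ends; [a0] is the default
     elsewhere. *)
  rewrite (big_distr_big_dep a0) /=; symmetry.
  pose to_l (f : {ffun vertex -> 'I_m}) := [ffun v => if side v then f (D v) else f v].
  pose to_f (l : {ffun vertex -> 'I_m}) := [ffun v => if side v then a0 else l v].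
  rewrite (reindex_onto to_f to_l) /=; last first.
    move=> f /pfamilyP[/supportP fa0 _]; apply/ffunP=> v; rewrite !ffunE.
    case: (boolP (side v)) => sv //; symmetry; apply: fa0; exact: (introT negPn sv).
  apply: eq_big => [l|l _].
    apply/andP/forallP => [[_ /eqP E] v|lD].
      by rewrite -E !ffunE sideD DK; case: (side v); rewrite ?ffunE ?sideD.
    split; last first.
      apply/eqP/ffunP=> v; rewrite !ffunE sideD.
      by case: (side v) => //=; rewrite (eqP (lD v)).
    by apply/pfamilyP; split=> //; apply/supportP=> v /negPn sv; rewrite ffunE sv.
  by apply: eq_bigr => v nv; rewrite ffunE (negPf nv).
transitivity (\prod_(v | ~~ side v) (l' (D v) == l' v)%:R : R).
  apply: eq_bigr => v _; rewrite /G.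
  have /matrixP/(_ (l' v) (l' (D v))) := gh; rewrite !mxE => ->.
  by rewrite eq_sym.
have [/forallP lD|/forallPn[v0 nv0]] := boolP (compat l').
  by rewrite big1 // => v _; rewrite lD.
have [v nv lv] : exists2 v, ~~ side v & l' (D v) != l' v.
  case: (boolP (side v0)) => sv; last by exists v0.
  by exists (D v0); rewrite ?sideD ?negbK // DK eq_sym.
by rewrite (bigD1 v) //= (negPf lv) mul0r.
Qed.

Definition groupCoef (I J : index) : R :=
  \prod_(k < r + s) (if (k < r)%N then g (I k) (J k) else h (J k) (I k)).
Let groupCoefV (I J : index) : R :=
  \prod_(k < r + s) (if (k < r)%N then h (I k) (J k) else g (J k) (I k)).

Let groupCoefVK I L : \sum_J groupCoefV I J * groupCoef J L = (I == L)%:R.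
Proof.
pose F (k : 'I_(r + s)) a : R := if (k < r)%N then h (I k) a * g a (L k) else g a (I k) * h (L k) a.
transitivity (\sum_(J : index) \prod_k F k (J k)).
  apply: eq_bigr => J _; rewrite -big_split; apply: eq_bigr => k _ /=.
  by rewrite /F; case: ifP.
rewrite -bigA_distr_bigA /=; transitivity (\prod_k (I k == L k)%:R : R).
  apply: eq_bigr => k _; rewrite /F; case: (k < r)%N.
    by have /matrixP/(_ (I k) (L k)) := hg; rewrite !mxE.
  under eq_bigr do rewrite mulrC.
  by have /matrixP/(_ (L k) (I k)) := hg; rewrite !mxE eq_sym.
have [->|/eqP neqIL] := eqVneq I L; first by rewrite big1 // => k _; rewrite eqxx.
have [k neqk] : exists k, I k != L k.
  apply/existsP; apply: contra_notT neqIL => /existsPn E; apply/ffunP=> k.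
  by apply/eqP; move: (E k); rewrite negbK.
by rewrite (bigD1 k) //= (negPf neqk) mul0r.
Qed.

(** By [sum_compatible_labels], conjugation by [g] fixes the matrix of [D]; this is [inv], and
    cancelling the inverse gives commutation. The ring is arbitrary so that [g] can be the generic
    matrix over [K[GL(m)]]. *)
Lemma groupCoef_diagram I L :
  \sum_J groupCoef I J * (compatible D L J)%:R = \sum_J groupCoef J L * (compatible D J I)%:R.
Proof.
have inv J' : \sum_H \sum_J groupCoefV H J' * groupCoef I J * (compatible D H J)%:R =
    (compatible D J' I)%:R.
  pose lab (H J : index) := [ffun v => vertexLabel H J v].
  have labE H J : compatible D H J = compat (lab H J).
    by apply: eq_forallb => v; rewrite !ffunE.
  rewrite labE -sum_compatible_labels pair_big /= [RHS]big_mkcond /=.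
  rewrite [RHS](reindex (fun u : index * index => lab u.1 u.2)) /=; last first.
    exists (fun l => ([ffun k => l (false, k)], [ffun k => l (true, k)])).
      by move=> [H J] _; congr (_, _); apply/ffunP=> k; rewrite !ffunE.
    by move=> l _; apply/ffunP=> -[[] k]; rewrite !ffunE /vertexLabel /= ffunE.
  apply: eq_bigr => -[H J] _ /=; rewrite -labE; case: ifP => _; last by rewrite mulr0.
  rewrite mulr1 /groupCoef /groupCoefV.
  have -> : \prod_v factor (lab J' I) (lab H J) v =
      (\prod_k factor (lab J' I) (lab H J) (false, k)) *
      (\prod_k factor (lab J' I) (lab H J) (true, k)).
    rewrite (eq_bigr (fun v => factor (lab J' I) (lab H J) (v.1, v.2))) => [|[] //].
    rewrite -(pair_bigA _ (fun b k => factor (lab J' I) (lab H J) (b, k))) /=.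
    by rewrite big_bool mulrC.
  congr (_ * _); apply: eq_bigr => k _.
    by rewrite /factor /side /leftOfWall !ffunE /vertexLabel /=; case: (k < r)%N.
  by rewrite /factor /side /leftOfWall !ffunE /vertexLabel /=; case: (k < r)%N.
under [RHS]eq_bigr => J' _ do rewrite -inv mulr_sumr.
rewrite [RHS]exchange_big [RHS](bigD1 L) //= [X in _ = _ + X]big1 ?addr0; last first.
  move=> H neqHL; under eq_bigr do rewrite mulr_sumr.
  rewrite exchange_big big1 //= => J _.
  transitivity ((\sum_J' groupCoefV H J' * groupCoef J' L) * (groupCoef I J * (compatible D H J)%:R)).
    by rewrite mulr_suml; apply: eq_bigr => J' _; rewrite !mulrA [groupCoef J' L * _]mulrC.
  by rewrite groupCoefVK (negPf neqHL) mul0r.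
under [RHS]eq_bigr do rewrite mulr_sumr.
rewrite [RHS]exchange_big; apply: eq_bigr => J _ /=.
transitivity ((\sum_J' groupCoefV L J' * groupCoef J' L) * (groupCoef I J * (compatible D L J)%:R)).
  by rewrite groupCoefVK eqxx mul1r.
by rewrite mulr_suml; apply: eq_bigr => J' _; rewrite !mulrA [groupCoef J' L * _]mulrC.
Qed.
End DiagramInvariance.

Section PermutationDiagram.
Variables (r s : nat) (p : 'S_(r + s)).
Hypothesis p_side : forall k, (p k < r)%N = (k < r)%N.

Let f (v : vertex r s) : vertex r s := (~~ v.1, if v.1 then p v.2 else (p^-1)%g v.2).

Lemma permDiagram_subproof : isDiagram [ffun v => f v].
Proof.
apply/isDiagramP; split=> -[[] k]; rewrite !ffunE /f /=.
- by rewrite permK.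
- by rewrite permKV.
- by apply/eqP.
- by apply/eqP.
- by rewrite /leftOfWall /= p_side negbK.
- by rewrite /leftOfWall /= -p_side permKV.
Qed.
Definition permDiagram : diagram r s := Diagram permDiagram_subproof.

Lemma compatible_perm m (I J : {ffun 'I_(r + s) -> 'I_m}) :
  compatible permDiagram I J = (J == [ffun k => I (p k)]).
Proof.
apply/forallP/eqP => [H|-> [[] k]]; rewrite /vertexLabel.
- by apply/ffunP=> k; have := H (true, k); rewrite !ffunE /vertexLabel /= => /eqP.
- by rewrite ffunE /= ffunE.
- by rewrite ffunE /= ffunE permKV.
Qed.
End PermutationDiagram.

(** * Matrix coefficients of commuting endomorphisms *)

Section Commutant.
Variables (K : fieldType) (m r s : nat) (phi : 'End(mixedTensor K m r s)).
Local Notation index := {ffun 'I_(r + s) -> 'I_m}.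
Implicit Types I J L : index.

Definition matCoef I J : K := phi (tensorBasis K J) I.

Lemma mixedTensor_expand (v : mixedTensor K m r s) : v = \sum_J v J *: tensorBasis K J.
Proof.
apply/ffunP=> I; rewrite sum_ffunE (bigD1 I) //= !ffunE eqxx big1 ?addr0.
  by rewrite [_ *: _]mulr1.
by move=> J neqJ; rewrite !ffunE eq_sym (negPf neqJ) [_ *: _]mulr0.
Qed.

Lemma matCoefE (v : mixedTensor K m r s) I : phi v I = \sum_J matCoef I J * v J.
Proof.
rewrite {1}[v]mixedTensor_expand linear_sum sum_ffunE; apply: eq_bigr => J _.
by rewrite linearZ ffunE [LHS]mulrC.
Qed.

Lemma brauerEndP : brauerEnd phi <-> forall (D : diagram r s) I J,
  \sum_L matCoef I L * (compatible D J L)%:R = \sum_L matCoef L J * (compatible D L I)%:R.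
Proof.
have actE (D : diagram r s) I J :
    phi (diagramAct (tensorBasis K J) D) I = \sum_L matCoef I L * (compatible D J L)%:R.
  by rewrite matCoefE; apply: eq_bigr => L _; rewrite diagramAct_basis.
split=> [phiB D I J|phiD v b].
  have := phiB (tensorBasis K J) (brauerDiagram _ D).
  by rewrite /brauerAct !brauer_ext => /ffunP/(_ I); rewrite actE ffunE.
rewrite /brauerAct linear_sum; apply: eq_bigr => D _; rewrite linearZ; congr (_ *: _).
apply/ffunP=> I; rewrite matCoefE ffunE.
under eq_bigr do rewrite ffunE mulr_sumr.
under [RHS]eq_bigr do rewrite matCoefE mulr_suml.
rewrite exchange_big [RHS]exchange_big /=; apply: eq_bigr => J _.
transitivity (v J * \sum_L matCoef I L * (compatible D J L)%:R).
  by rewrite mulr_sumr; apply: eq_bigr => L _; rewrite mulrCA.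
by rewrite phiD mulr_sumr; apply: eq_bigr => L _; rewrite mulrA [v J * _]mulrC.
Qed.

Hypothesis phiD : forall (D : diagram r s) I J,
  \sum_L matCoef I L * (compatible D J L)%:R = \sum_L matCoef L J * (compatible D L I)%:R.

Lemma matCoef_perm (p : 'S_(r + s)) I J : (forall k, (p k < r)%N = (k < r)%N) ->
  matCoef [ffun k => I (p k)] [ffun k => J (p k)] = matCoef I J.
Proof.
move=> p_side; have := phiD (permDiagram p_side) [ffun k => I (p k)] J.
rewrite (bigD1 [ffun k => J (p k)]) //= compatible_perm eqxx mulr1 big1 => [|L neqL]; last first.
  by rewrite compatible_perm (negPf neqL) mulr0.
rewrite addr0 => ->.
rewrite (bigD1 I) //= compatible_perm eqxx mulr1 big1 ?addr0 // => L neqL.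
rewrite compatible_perm; case: eqP => [/ffunP E|]; last by rewrite mulr0.
case/eqP: neqL; apply/ffunP=> k; have := E (p^-1%g k).
by rewrite !ffunE permKV.
Qed.

(** Commutation with the diagram [tau], whose horizontal edges join the possibly distant indices [l]
    and [l'] across the wall. *)
Lemma matCoef_contract (l l' : 'I_(r + s)) I J : (l < r)%N -> (r <= l')%N ->
  (J l == J l')%:R * (\sum_k matCoef I [ffun a => if a \in [:: l; l'] then k else J a]) =
  (I l == I l')%:R * (\sum_k matCoef [ffun a => if a \in [:: l; l'] then k else I a] J).
Proof.
move=> ltlr lerl'; have neql : l != l' by apply: contraTneq ltlr => ->; rewrite -leqNgt.
have sideE : (l < r)%N == (l' < r)%N = false by rewrite ltlr ltnNge lerl'.
have sumE (H : index) (F : index -> K) (c : index -> bool) :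
    (forall L, c L = [&& H l == H l', L l == L l' & [forall k, (k \notin [:: l; l']) ==> (L k == H k)]]) ->
    \sum_L F L * (c L)%:R =
    (H l == H l')%:R * \sum_k F [ffun a => if a \in [:: l; l'] then k else H a].
  move=> cE; under eq_bigr do rewrite cE.
  have [_|_] := eqVneq (H l) (H l'); last by rewrite mul0r big1 // => L _; rewrite mulr0.
  rewrite mul1r; pose upd k : index := [ffun a => if a \in [:: l; l'] then k else H a].
  have updl k : upd k l = k by rewrite ffunE inE eqxx.
  rewrite (bigID (fun L => [exists k, L == upd k])) /= [X in _ + X]big1 ?addr0; last first.
    move=> L /existsPn nL; case: andP => [[/eqP Lll /forallP LH]|]; last by rewrite mulr0.
    case/eqP: (nL (L l)); apply/ffunP=> a; rewrite ffunE; case: ifPn => [|na].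
      by rewrite !inE => /orP[]/eqP->.
    by apply/eqP; move: (LH a); rewrite na.
  rewrite (reindex_onto upd (fun L => L l)) /= => [|L /existsP[k /eqP->]]; last first.
    by rewrite updl.
  apply: eq_big => [k|k _]; first by rewrite updl eqxx andbT; apply/existsP; exists k.
  have -> : (upd k l == upd k l') && [forall a, (a \notin [:: l; l']) ==> (upd k a == H a)].
    rewrite !ffunE !inE !eqxx orbT eqxx /=; apply/forallP=> a; apply/implyP=> na.
    by rewrite ffunE (negPf na).
  by rewrite mulr1.
have := phiD (tau neql) I J; rewrite (sumE J) => [->|L]; last by rewrite compatible_tau sideE.
apply: sumE => L; rewrite compatible_tau sideE andbCA; congr [&& _, _ & _].
by apply: eq_forallb => k; rewrite eq_sym.
Qed.
End Commutant.

(** * Tensor coefficients as regular functions and their separation by distributions *)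

Section TensorCoefficients.
Variables (K : fieldType) (m r s : nat).
Local Notation index := {ffun 'I_(r + s) -> 'I_m}.
Local Notation poly := {mpoly K[m * m]}.
Implicit Types I J L : index.

Definition tensorPoly I J : poly :=
  \prod_(k < r + s) (if (k < r)%N then genericPoly K m (I k) (J k)
                     else (\adj (genericPoly K m)) (J k) (I k)).

Lemma coordGL_val_prod (T : finType) (F : T -> coordGL K m) :
  coordGL_val (\prod_k F k) = \prod_k coordGL_val (F k).
Proof. by apply: (big_morph (@coordGL_val K m)). Qed.

Lemma coordGL_val_sum (T : finType) (F : T -> coordGL K m) :
  coordGL_val (\sum_k F k) = \sum_k coordGL_val (F k).
Proof. by apply: (big_morph (@coordGL_val K m)). Qed.

Lemma tensorCoef_val I J :
  coordGL_val (tensorCoef K I J) = tofrac (tensorPoly I J) / tofrac (detPoly K m) ^+ s.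
Proof.
rewrite /tensorCoef coordGL_val_prod /tensorPoly rmorph_prod !big_split_ord /= -mulrA.
congr (_ * _); first by apply: eq_bigr => k _; rewrite ltn_ord mxE.
rewrite -exprVn -[X in _ ^+ X]card_ord -prodr_const -big_split /=.
apply: eq_bigr => k _; rewrite ltnNge leq_addr /=.
have -> : invGL K m (J (rshift r k)) (I (rshift r k)) =
    polyGL ((\adj (genericPoly K m)) (J (rshift r k)) (I (rshift r k))) * detinvGL K m.
  by rewrite mxE /genericGL -map_mx_adj mxE mulrC.
by [].
Qed.

Lemma evalMx_tensorPoly (g : 'M[K]_m) I J : evalMx g (tensorPoly I J) =
  \prod_(k < r + s) (if (k < r)%N then g (I k) (J k) else (\adj g) (J k) (I k)).
Proof.
have evG : map_mx (meval (fun k => mxvec g 0 k)) (genericPoly K m) = g.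
  by apply/matrixP=> i j; rewrite mxE [genericPoly K m i j]mxE mevalXU mxvecE.
rewrite /evalMx /tensorPoly rmorph_prod; apply: eq_bigr => k _.
by case: (k < r)%N; rewrite -[in RHS]evG -?map_mx_adj [RHS]mxE.
Qed.

Lemma matCoef_Psi (d : {scalar coordGL K m}) I J :
  matCoef (Psi r s d) I J = d (tensorCoef K I J).
Proof.
rewrite /matCoef lfunE /= ffunE (bigD1 J) //= ffunE eqxx mulr1 big1 ?addr0 // => L neqL.
by rewrite ffunE (negPf neqL) mulr0.
Qed.

(** The commutation holds in the coordinate ring for the generic matrix, and [d] is applied to that
    identity. *)
Lemma Psi_brauerEnd (m_gt0 : (0 < m)%N) (d : {scalar coordGL K m}) :
  brauerEnd (Psi r s d).
Proof.
apply/brauerEndP => D I J.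
have GV := genericGLV K m.
have := groupCoef_diagram m_gt0 GV (mulmx1C GV) D I J => /(congr1 d).
rewrite !linear_sum /= => E.
transitivity (\sum_L d (groupCoef (genericGL K m) (invGL K m) I L * (compatible D J L)%:R)).
  by apply: eq_bigr => L _; rewrite matCoef_Psi !mulr_natr raddfMn.
by rewrite E; apply: eq_bigr => L _; rewrite matCoef_Psi !mulr_natr raddfMn.
Qed.

(** On the line from the identity to [g], the jets give the coefficients of [p] one after the other,
    each once the lower ones are known to vanish; [g] is the point of parameter 1. *)
Lemma jets_vanish (f : coordGL K m) (p : poly) k :
  coordGL_val f = tofrac p / tofrac (detPoly K m) ^+ k ->
  (forall d : {scalar coordGL K m},
     (exists N, forall n h, (N < n)%N -> augIdealPow n h -> d h = 0) -> d f = 0) ->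
  forall g, evalMx g p = 0.
Proof.
move=> fE f0 g; pose z := g - 1%:M.
suff E0 : alongLine z p = 0.
  have := alongLine_eval z p 1; rewrite E0 horner0 scale1r /z addrCA subrr addr0.
  by move=> <-.
apply/polyP=> i; rewrite coef0; have [n] := ubnP i; elim: n i => // n IHn i ltin.
have [d [d_ker dE]] := jet_exists z i.
rewrite -(dE _ _ _ fE) => [|j ltji]; last by apply: IHn; rewrite (leq_trans ltji).
by apply: f0; exists i.
Qed.

(** A relation killed by all distributions vanishes at every invertible matrix, and
    [functional_vanishing] transfers it to [phi]. The factor [det g ^ s] passes between inverse and
    adjugate. *)
Lemma brauerEnd_separation (K_infinite : forall S : seq K, exists x : K, x \notin S)
    (m_gt0 : (0 < m)%N) (phi : 'End(mixedTensor K m r s)) (a : index -> index -> K) :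
  brauerEnd phi ->
  (forall d : {scalar coordGL K m},
     (exists N, forall n h, (N < n)%N -> augIdealPow n h -> d h = 0) ->
     \sum_I \sum_J a I J * d (tensorCoef K I J) = 0) ->
  \sum_I \sum_J a I J * matCoef phi I J = 0.
Proof.
move=> /brauerEndP phiD a_dist.
pose f : coordGL K m := \sum_I \sum_J a I J *: tensorCoef K I J.
pose p : poly := \sum_I \sum_J (a I J)%:MP * tensorPoly I J.
have fE : coordGL_val f = tofrac p / tofrac (detPoly K m) ^+ s.
  rewrite coordGL_val_sum /p rmorph_sum mulr_suml; apply: eq_bigr => I _.
  rewrite coordGL_val_sum rmorph_sum mulr_suml; apply: eq_bigr => J _ /=.
  rewrite rmorphM -mulrA -tensorCoef_val.
  by [].
have p0 : forall g, evalMx g p = 0.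
  apply: (jets_vanish fE) => d d_dist; rewrite -[RHS](a_dist d d_dist) linear_sum.
  by apply: eq_bigr => I _; rewrite linear_sum; apply: eq_bigr => J _; rewrite linearZ.
apply: (functional_vanishing K_infinite m_gt0 (matCoef_perm phiD) (matCoef_contract phiD)).
move=> g ug; have := p0 g; rewrite /p /evalMx rmorph_sum => E.
have detg : \det g ^+ s != 0 by rewrite expf_neq0 // -unitfE -unitmxE.
apply: (mulfI detg); rewrite mulr0; apply: etrans E.
rewrite mulr_sumr; apply: eq_bigr => I _; rewrite rmorph_sum mulr_sumr.
apply: eq_bigr => J _; rewrite rmorphM /= mevalC -/(evalMx g _) evalMx_tensorPoly mulrCA.
congr (_ * _); rewrite !big_split_ord /= mulrCA; congr (_ * _).
  by apply: eq_bigr => k _; rewrite ltn_ord.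
rewrite -[X in _ ^+ X]card_ord -prodr_const -big_split /=; apply: eq_bigr => k _.
rewrite ltnNge leq_addr /= /invmx ug mxE mulrA divff ?mul1r //.
by rewrite -unitfE -unitmxE.
Qed.
End TensorCoefficients.

Theorem proposition3p2 (K : fieldType)
    (K_infinite : forall S : seq K, exists x : K, x \notin S)
    (m r s : nat) (m_gt0 : (0 < m)%N) (phi : 'End(mixedTensor K m r s)) :
  rationalSchur phi <-> brauerEnd phi.
Proof.
split=> [[d _ ->]|phiB]; first exact: Psi_brauerEnd.
pose IJ := ({ffun 'I_(r + s) -> 'I_m} * {ffun 'I_(r + s) -> 'I_m})%type.
(* Vanishing is asked on all powers beyond [N], so that finitely many functionals have a common
   bound, for instance the sum of theirs. *)
pose jet := {d : {scalar coordGL K m} |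
  exists N, forall n h, (N < n)%N -> augIdealPow n h -> d h = 0}.
pose u (j : 'I_#|{: IJ}|) : IJ := enum_val j.
pose w (d : jet) : 'rV[K]_#|{: IJ}| := \row_j sval d (tensorCoef K (u j).1 (u j).2).
pose v : 'rV[K]_#|{: IJ}| := \row_j matCoef phi (u j).1 (u j).2.
have sumE (F : IJ -> K) (a : 'cV_#|{: IJ}|) :
    ((\row_j F (u j)) *m a) 0 0 = \sum_I \sum_J a (enum_rank (I, J)) 0 * F (I, J).
  rewrite mxE pair_bigA /= (reindex (@enum_rank IJ)) /=; last first.
    by exists enum_val => x _; rewrite ?enum_rankK ?enum_valK.
  by apply: eq_bigr => -[I J] _; rewrite mxE /u enum_rankK mulrC.
have [|k [x [c vE]]] := @span_separation _ _ jet w v.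
  move=> a wa; apply/matrixP=> i j; rewrite !ord1 [RHS]mxE.
  apply: etrans (sumE (fun t => matCoef phi t.1 t.2) a) _ => /=.
  apply: (brauerEnd_separation K_infinite m_gt0 phiB) => d d_jet.
  have := wa (exist _ d d_jet); move/matrixP/(_ 0 0).
  by move=> E; rewrite -[LHS](sumE (fun t => d (tensorCoef K t.1 t.2))) [LHS]E [LHS]mxE.
pose del f := \sum_i c i * sval (x i) f.
have del_lin : linear_for *%R del.
  move=> b f g; rewrite /del mulr_sumr -big_split; apply: eq_bigr => i _ /=.
  by rewrite linearP mulrDr mulrCA.
pose d : {scalar coordGL K m} := HB.pack_for {scalar coordGL K m} del
  (GRing.isLinear.Build K (coordGL K m) K *%R del del_lin).
exists d.
  exists (\sum_i sval (cid (svalP (x i))))%N => f f_aug; apply: big1 => i _.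
  rewrite (svalP (cid (svalP (x i))) _ _ _ f_aug) ?mulr0 // ltnS.
  by rewrite (bigD1 i) //= leq_addr.
apply/lfunP=> y; apply/ffunP=> I; rewrite !matCoefE; apply: eq_bigr => J _.
rewrite matCoef_Psi; congr (_ * _).
have := congr1 (fun t : 'rV_#|{: IJ}| => t 0 (enum_rank (I, J))) vE.
rewrite mxE /u enum_rankK /= => ->.
by rewrite summxE; apply: eq_bigr => i _; rewrite !mxE /u enum_rankK.
Qed.
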